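(* For every $\mathbf{o}$-symmetric convex body $\mathbf{M}$ in $\mathbb{E}^2$ and every $\lambda\ge 1$, $$\delta^{\mathrm{lattice}}_{\mathbb{M}}(\lambda)=\delta^{\mathrm{lattice}}_{\mathbb{M}},$$ where $\mathbb{M}$ is the normed plane with unit ball $\mathbf{M}$.
   Context: An $\mathbf{o}$-symmetric convex body in the Euclidean plane $\mathbb{E}^2$ is a compact convex set $\mathbf{M}$ with non-empty interior and $\mathbf{M}=-\mathbf{M}$. It is the unit ball of the normed plane $\mathbb{M}$ with norm $\|\mathbf{x}\|_{\mathbb{M}}:=\min\{\mu>0 : \mathbf{x}\in\mu\mathbf{M}\}$ for $\mathbf x\neq\mathbf o$ (and $\|\mathbf o\|_{\mathbb M}=0$). A lattice packing of unit balls in $\mathbb{M}$ is a family $\mathcal{P}=\{\mathbf{c}+\mathbf{M} : \mathbf{c}\in\Lambda\}$, where $\Lambda$ is a (full-rank) lattice of $\mathbb{E}^2$ with $\|\mathbf{c}-\mathbf{c}'\|_{\mathbb{M}}\ge 2$ for all distinct $\mathbf{c},\mathbf{c}'\in\Lambda$. Put $\mathbf{P}:=\bigcup_{\mathbf{c}\in\Lambda}(\mathbf{c}+\mathbf{M})$ and, for $\lambda\ge 0$, $\mathbf{P}_\lambda:=\bigcup_{\mathbf{c}\in\Lambda}(\mathbf{c}+(1+\lambda)\mathbf{M})$. Let $\mathbf{B}^2$ be the closed Euclidean unit disk centered at the origin and let $\mathrm{area}$ be the Lebesgue measure. Define $$\delta_{\mathbb{M}}(\mathcal{P}):=\limsup_{R\to+\infty}\frac{\mathrm{area}(\mathbf{P}\cap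 R\mathbf{B}^2)}{\mathrm{area}(R\mathbf{B}^2)},\qquad \delta_{\mathbb{M}}(\lambda,\mathcal{P}):=\limsup_{R\to+\infty}\frac{\mathrm{area}(\mathbf{P}\cap R\mathbf{B}^2)}{\mathrm{area}(\mathbf{P}_\lambda\cap R\mathbf{B}^2)}.$$ Then $\delta^{\mathrm{lattice}}_{\mathbb{M}}$ is the supremum of $\delta_{\mathbb{M}}(\mathcal{P})$, and $\delta^{\mathrm{lattice}}_{\mathbb{M}}(\lambda)$ is the supremum of $\delta_{\mathbb{M}}(\lambda,\mathcal{P})$, both taken over all lattice packings $\mathcal{P}$ of unit balls in $\mathbb{M}$. *)

(* Defs.v *)
From HB Require Import structures.
From mathcomp Require Import all_boot all_order all_algebra.
From mathcomp Require Import all_classical all_reals all_analysis.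
Import Order.TTheory GRing.Theory Num.Theory.
Import numFieldNormedType.Exports.

Set Implicit Arguments.
Unset Strict Implicit.
Unset Printing Implicit Defensive.

Local Open Scope classical_set_scope.
Local Open Scope ring_scope.

(* The plane E^2 is R * R.  Its library topology is the product topology, which
   is the Euclidean one, but its library norm is the max norm: the Euclidean
   disk below is therefore written with coordinates. *)

Section Plane.
Context {R : realType}.
Implicit Types (A M L : set (R * R)) (b c x : R * R) (r lambda : R).

Definition dilate r A : set (R * R) := [set r *: x | x in A].
Definition translate c A : set (R * R) := [set c + x | x in A].

Definition unit_disk : set (R * R) := [set x | x.1 ^+ 2 + x.2 ^+ 2 <= 1].

Definition area A : \bar R :=
  ((@lebesgue_measure R) \x (@lebesgue_measure R))%E A.

Definition symmetric_convex_body M : Prop :=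
  [/\ compact M, convex_set M, interior M !=set0 & M = [set - x | x in M] ].

(* For a symmetric convex body M and x != 0, the set below is closed in
   ]0, +oo[ and bounded away from 0, so that its infimum is a minimum. *)
Definition body_norm M x : R :=
  if x == 0 then 0 else inf [set mu : R | 0 < mu /\ dilate mu M x].

Definition linearly_independent b1 b2 : Prop :=
  forall s t : R, s *: b1 + t *: b2 = 0 -> s = 0 /\ t = 0.

Definition full_rank_lattice L : Prop :=
  exists b1 b2, linearly_independent b1 b2 /\
    L = [set b1 *~ m.1 + b2 *~ m.2 | m in [set: int * int] ].

(* The lattice packing {c + M | c in L} is represented by its set L of
   centers. *)
Definition lattice_packing M L : Prop :=
  full_rank_lattice L /\
  forall c c', L c -> L c' -> c != c' -> 2 <= body_norm M (c - c').

Definition packing_union M L : set (R * R) :=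
  \bigcup_(c in L) translate c M.

Definition soft_packing_union lambda M L : set (R * R) :=
  \bigcup_(c in L) translate c (dilate (1 + lambda) M).

Definition packing_density M L : \bar R :=
  limf_esup (fun r : R =>
    area (packing_union M L `&` dilate r unit_disk)
      / area (dilate r unit_disk))%E
    (+oo : set_system R).

Definition soft_packing_density lambda M L : \bar R :=
  limf_esup (fun r : R =>
    area (packing_union M L `&` dilate r unit_disk)
      / area (soft_packing_union lambda M L `&` dilate r unit_disk))%E
    (+oo : set_system R).

Definition lattice_density M : \bar R :=
  ereal_sup [set packing_density M L | L in lattice_packing M].

Definition soft_lattice_density lambda M : \bar R :=
  ereal_sup [set soft_packing_density lambda M L | L in lattice_packing M].

End Plane.

(* Main.v *)
(* Write N for the norm with unit ball M, and let L be a lattice packing with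
   shortest vectors of norm 2a, so that a >= 1 and L0 = L / a is a packing whose
   shortest vectors have norm 2.  Since P_lambda has at most full density,
   passing from the density to the soft density only increases it, and the point
   is to find a lattice packing L' whose covolume is at most the area, per cell
   of L, of the part of the plane within N-distance 2 of L.

   Voronoi cells with respect to N are star-shaped, so the cell of L0 lies in
   that of L = a L0, and this area does not decrease when passing from L0 to L.
   For L0 take a vector p of norm 2 and the apex q of the lens
   {N x <= 2, N (x - p) <= 2}: then p, q, q - p have norm 2, the lattice spanned
   by p and q is a packing, and the translates of 2M by multiples of p cover the
   strip {s p + t q : 0 <= t <= 1}.  Either some vector of L0 has q-coordinate t
   with 0 < |t| < 1; then translates of this strip cover the plane and L' = L0
   works.  Or the half-open parallelogram on p, q packs under L0 and lies in the
   union of the discs of radius 2; then L' = Zp + Zq works. *)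
Require Import Defs.
From HB Require Import structures.
From mathcomp Require Import all_boot all_order all_algebra finmap.
From mathcomp Require Import all_classical all_reals all_analysis.
From mathcomp Require Import measurable_realfun ring lra zify.
Import Order.TTheory GRing.Theory Num.Theory.
Import numFieldNormedType.Exports.

Set Implicit Arguments.
Unset Strict Implicit.
Unset Printing Implicit Defensive.

Local Open Scope classical_set_scope.
Local Open Scope ring_scope.

(** * Area under affine maps; measurability of open and closed sets *)

Section PlaneMeasure.
Context {R : realType}.
Notation mu := (@lebesgue_measure R).
Notation line := (measurableTypeR R).
Notation plane := (line * line)%type.

Lemma measurable_affine (r c : R) :
  measurable_fun setT (fun x : line => r * x + c : line).
Proof.
apply: (@continuous_measurable_fun R) => x.
by apply: cvgD; [apply: cvgM => //; exact: cvg_cst|exact: cvg_cst].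
Qed.

(** As functions of [A], both sides are measures, and they agree on half-open intervals; Lebesgue
    measure is unique with these values. *)
Lemma lebesgue_measure_affine (r c : R) (A : set line) : 0 < r ->
  measurable A ->
  (r%:E * mu ((fun x : line => r * x + c)%R @^-1` A))%E = mu A.
Proof.
move=> r0 mA; have mf := measurable_affine r c.
pose m := mscale (NngNum (ltW r0)) (pushforward mu (fun x : line => r * x + c : line)).
apply/esym/(@lebesgue_measure_unique R (m mf)) => // _ [[a b]] _ <-.
transitivity (r%:E * mu (`](a - c)%R / r, (b - c)%R / r]%classic)%R)%E; last first.
  by congr (_ * mu _)%E; apply/esym/seteqP; split => x /=;
    rewrite !in_itv /= ltr_pdivrMr// ler_pdivlMr// (mulrC r) ltrBlDr lerBrDr.
rewrite !lebesgue_measure_itv /= !lte_fin ltr_pM2r ?invr_gt0// ltrD2r.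
case: ifPn => _; last by rewrite mule0.
by rewrite -!EFinB -EFinM -mulrBl opprB addrA subrK mulrCA divff ?gt_eqF// mulr1.
Qed.

Lemma measurable_affine_plane (r : R) (c : R * R) :
  measurable_fun setT (fun x : plane => (r * x.1 + c.1, r * x.2 + c.2) : plane).
Proof.
apply/measurable_fun_pairP; split; rewrite /comp /=.
  by apply: (measurableT_comp (measurable_affine r c.1)); exact: measurable_fst.
by apply: (measurableT_comp (measurable_affine r c.2)); exact: measurable_snd.
Qed.

(** By uniqueness of the product measure it suffices to check rectangles, where each coordinate
    contributes one factor [r]. *)
Lemma area_affine (r : R) (c : R * R) (A : set plane) : 0 < r ->
  measurable A ->
  ((r ^+ 2)%:E * area ((fun x : R * R => r *: x + c)%R @^-1` A))%E = area A.
Proof.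
move=> r0 mA; have mf := measurable_affine_plane r c.
pose m := mscale (NngNum (sqr_ge0 r))
  (pushforward (mu \x mu)%E (fun x : plane => (r * x.1 + c.1, r * x.2 + c.2) : plane)).
apply/esym/(product_measure_unique _ _ (m' := m mf)) => // X Y mX mY.
pose X' := (fun x : line => r * x + c.1)%R @^-1` X.
pose Y' := (fun x : line => r * x + c.2)%R @^-1` Y.
have mX' : measurable (X' : set line).
  by rewrite -[X in measurable X]setTI; exact: measurable_affine.
have mY' : measurable (Y' : set line).
  by rewrite -[X in measurable X]setTI; exact: measurable_affine.
transitivity ((r ^+ 2)%:E * (mu \x mu) (X' `*` Y'))%E; first by [].
rewrite product_measure1E// expr2 EFinM muleACA.
by congr (_ * _)%E; exact: lebesgue_measure_affine.
Qed.

Lemma measurable_translate c (A : set plane) :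
  measurable A -> measurable (translate c A : set plane).
Proof.
move=> mA; have -> : translate c A = [set x | A (1 * x.1 + (-c).1, 1 * x.2 + (-c).2)].
  apply/seteqP; split=> x /=.
    by case=> y Ay <-; rewrite !mul1r /= addrAC subrr add0r addrAC subrr add0r -surjective_pairing.
  move=> Ax; exists (x - c); last by rewrite addrC subrK.
  by move: Ax; rewrite !mul1r.
rewrite -[X in measurable X]setTI.
exact: (measurable_affine_plane 1 (- c) measurableT).
Qed.

Lemma area_translate c (A : set plane) : measurable A -> area (translate c A) = area A.
Proof.
move=> mA; rewrite -(@area_affine 1 c (translate c A)) //; last exact: measurable_translate.
rewrite expr1n mul1e; congr area; apply/seteqP; split => x /=.
  by case=> y Ay /eqP; rewrite scale1r addrC (inj_eq (addIr c)) => /eqP <-.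
by move=> Ax; exists x => //; rewrite scale1r addrC.
Qed.

Lemma dilate_preimage r (A : set (R * R)) : 0 < r ->
  dilate r A = (fun x : R * R => r^-1 *: x) @^-1` A.
Proof.
move=> r0; have rn0 : r != 0 by rewrite gt_eqF.
apply/seteqP; split => x /=; first by case=> y Ay <-; rewrite scalerA mulVf// scale1r.
by exists (r^-1 *: x) => //; rewrite scalerA mulfV// scale1r.
Qed.

Lemma measurable_dilate r (A : set plane) : 0 < r ->
  measurable A -> measurable (dilate r A : set plane).
Proof.
move=> r0 mA; rewrite dilate_preimage// -[X in measurable X]setTI.
have -> : (fun x : R * R => r^-1 *: x) = fun x => (r^-1 * x.1 + (0 : R * R).1, r^-1 * x.2 + (0 : R * R).2).
  by apply/funext => x; rewrite !addr0.
exact: (measurable_affine_plane r^-1 0 measurableT).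
Qed.

Lemma area_dilate r (A : set plane) : 0 < r -> measurable A ->
  area (dilate r A) = ((r ^+ 2)%:E * area A)%E.
Proof.
move=> r0 mA; rewrite -(@area_affine r 0 (dilate r A)) //; last exact: measurable_dilate.
congr (_ * area _)%E; rewrite dilate_preimage//; apply/seteqP; split => x /=;
  by rewrite addr0 scalerA mulVf ?gt_eqF// scale1r.
Qed.

Lemma area_measure_subset (A B : set plane) :
  measurable A -> measurable B -> A `<=` B -> (area A <= area B)%E.
Proof. by move=> mA mB AB; apply: (@le_measure _ _ _ (mu \x mu)%E); rewrite ?inE. Qed.

(** The sigma-algebra of the plane is the product one, so an open set is written as a countable
    union of rational boxes. [G k] is the box of index [k] if that box lies in [A], and is empty
    otherwise. *)
Lemma open_measurable_plane (A : set (R * R)) : open A -> measurable (A : set plane).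
Proof.
move=> oA.
pose Q (a b c d : rat) : set (R * R) := `]ratr a, ratr b[ `*` `]ratr c, ratr d[.
pose G (k : rat * rat * (rat * rat)) :=
  [set x | Q k.1.1 k.1.2 k.2.1 k.2.2 x /\ Q k.1.1 k.1.2 k.2.1 k.2.2 `<=` A].
have -> : A = \bigcup_k G k.
  apply/seteqP; split=> [x Ax|x [k _ [Qx]]]; last exact.
  have : nbhs x A by exact: open_nbhs_nbhs.
  move=> /nbhs_ballP[e /= e0 eA].
  have near_rat (y : R) : exists a b : rat,
      [/\ ratr a < y, y < ratr b, y - e < ratr a & ratr b < y + e].
    have [a aP] : exists a : rat, ratr a \in `]y - e, y[.
      by apply: rat_in_itvoo; rewrite ltrBlDr ltrDl.
    have [b bP] : exists b : rat, ratr b \in `]y, y + e[.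
      by apply: rat_in_itvoo; rewrite ltrDl.
    by move: aP bP; rewrite !in_itv /= => /andP[? ?] /andP[? ?]; exists a, b.
  have [a [b [ax xb ea eb]]] := near_rat x.1.
  have [c [d [cx xd ec ed]]] := near_rat x.2.
  have QA : Q a b c d `<=` A.
    move=> y [/=]; rewrite !in_itv /= => /andP[? ?] /andP[? ?]; apply: eA.
    by split; rewrite /ball /= ltr_distlC; apply/andP; split; lra.
  exists (a, b, (c, d)) => //; split=> //.
  by split; rewrite /= in_itv /=; apply/andP.
apply: countable_bigcupT_measurable => // k.
have [QA|nQA] := pselect (Q k.1.1 k.1.2 k.2.1 k.2.2 `<=` A).
  have -> : G k = Q k.1.1 k.1.2 k.2.1 k.2.2.
    by apply/seteqP; split=> [x [] //|x Qx]; split.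
  by apply: measurableX; exact: measurable_itv.
have -> : G k = set0.
  by rewrite -subset0 => x [_ /nQA].
exact: measurable0.
Qed.

Lemma closed_measurable_plane (A : set (R * R)) : closed A -> measurable (A : set plane).
Proof.
move=> cA; rewrite -(setCK A); apply: measurableC.
by apply: open_measurable_plane; exact: closed_openC.
Qed.

End PlaneMeasure.

(** * Plane norms: the gauge of a convex body and the Euclidean norm *)

Section Gauge.
Context {R : realType}.
Implicit Types (x y : R * R) (N : R * R -> R).

(** The two comparisons with the max norm carry definiteness, continuity and boundedness of balls.
    The record serves both the gauge of [M] and the Euclidean norm. *)
Record plane_norm N : Prop := PlaneNorm {
  plane_normZ : forall t x, N (t *: x) = `|t| * N x;
  plane_normD : forall x y, N (x + y) <= N x + N y;
  plane_norm_upper : exists2 b, 0 < b & forall x, N x <= b * `|x|;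
  plane_norm_lower : exists2 a, 0 < a & forall x, `|x| <= a * N x }.

Lemma plane_eq x y : x.1 = y.1 -> x.2 = y.2 -> x = y.
Proof. by case: x y => [? ?] [? ?] /= -> ->. Qed.

Lemma body_norm0 (M : set (R * R)) : body_norm M 0 = 0.
Proof. by rewrite /body_norm eqxx. Qed.

Lemma convex_setP (M : set (R * R)) : convex_set M ->
  forall x y (t : R), 0 <= t <= 1 -> M x -> M y -> M (t *: x + (1 - t) *: y).
Proof.
move=> cM x y t /andP[t0 t1] Mx My.
by have := cM x y (Itv01 t0 t1) (mem_set Mx) (mem_set My); rewrite inE.
Qed.

Section Body.
Variable M : set (R * R).
Hypothesis hM : symmetric_convex_body M.

Let convM : forall x y (t : R), 0 <= t <= 1 -> M x -> M y -> M (t *: x + (1 - t) *: y).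
Proof. by case: hM => _ /convex_setP. Qed.

Let oppM x : M x -> M (- x).
Proof. by move=> Mx; case: hM => _ _ _ ->; exists x. Qed.

Let closedM : closed M.
Proof. by case: hM => /compact_closed + _ _ _; apply; exact: norm_hausdorff. Qed.

(** If [M] contains a ball around [c], it contains the mirror ball around [- c], and [x] is the
    midpoint of [c + x] and [- (c - x)]. *)
Let ballM : exists2 e, 0 < e & forall x, `|x| < e -> M x.
Proof.
case: hM => _ _ [c /nbhs_ballP[e /= e0 eM]] _; exists e => // x xe.
have M1 : M (c + x) by apply: eM; rewrite -ball_normE /ball_ /= opprD addrA subrr add0r normrN.
have M2 : M (- (c - x)).
  by apply/oppM/eM; rewrite -ball_normE /ball_ /= opprB addrC subrK.
have -> : x = 2^-1 *: (c + x) + (1 - 2^-1) *: (- (c - x)).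
  by apply: plane_eq; rewrite /= /GRing.scale /=; field.
by apply: convM => //; lra.
Qed.

Let boundM : exists2 K, 0 < K & forall x, M x -> `|x| <= K.
Proof.
case: hM => /compact_bounded[K [_ KM]] _ _ _; exists (`|K| + 1); first by rewrite ltr_wpDl.
by move=> x /KM; apply; rewrite (le_lt_trans (ler_norm _))// ltrDl.
Qed.

Let shrinkM x (t : R) : 0 <= t <= 1 -> M x -> M (t *: x).
Proof.
move=> t01 Mx; have [e e0 eM] := ballM.
by rewrite -[_ *: _]addr0 -(scaler0 _ (1 - t)); apply: convM => //; apply: eM; rewrite normr0.
Qed.

(** The infimum is attained: for [s > r] the point [s^-1 *: x] lies in [M], which is star-shaped at
    the origin, and these points converge to [r^-1 *: x] in the closed set [M]. *)
Lemma body_norm_leP x r : 0 < r -> (body_norm M x <= r) <-> M (r^-1 *: x).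
Proof.
move=> r0; have [e e0 eM] := ballM.
have [->|x0] := eqVneq x 0.
  by rewrite body_norm0 (ltW r0) scaler0; split=> // _; apply: eM; rewrite normr0.
rewrite /body_norm (negbTE x0); set S := [set mu | _].
have Sle (mu : R) : S mu <-> 0 < mu /\ M (mu^-1 *: x).
  by rewrite /S /=; split=> -[mu0 dM]; split=> //; move: dM; rewrite dilate_preimage.
have hiS : has_inf S.
  split; last by exists 0 => mu [/ltW].
  exists (2 * `|x| / e); apply/Sle.
  have nx : 0 < `|x| by rewrite normr_gt0.
  split; first by rewrite divr_gt0// mulr_gt0.
  apply: eM; rewrite normrZ gtr0_norm ?invr_gt0 ?divr_gt0 ?mulr_gt0//.
  rewrite (_ : _ * _ = e / 2); last by field; rewrite !gt_eqF.
  by lra.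
split=> [xr|Mx]; last first.
  by apply: ge_inf; [exact: hiS.2|apply/Sle].
have Mgt s : r < s -> M (s^-1 *: x).
  move=> rs; have s0 := lt_trans r0 rs.
  have /inf_adherent/(_ hiS)[mu /Sle[mu0 Mmu] mus] : 0 < s - inf S by rewrite subr_gt0 (le_lt_trans xr).
  have {}mus : mu < s by move: mus; rewrite addrC subrK.
  rewrite (_ : s^-1 *: x = (mu / s) *: (mu^-1 *: x)); last first.
    by rewrite scalerA mulrAC mulfV ?gt_eqF// mul1r.
  apply: shrinkM => //; apply/andP; split; first by apply: divr_ge0; exact: ltW.
  by rewrite ler_pdivrMr// mul1r ltW.
apply: closedM => B /nbhs_ballP[d /= d0 dB].
have nx : 0 < `|x| by rewrite normr_gt0.
(* With this [s], the distance from [r^-1 *: x] to [s^-1 *: x] is [d] times [r / s] times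
   [|x| / (|x| + 1)], two factors below 1. *)
pose s := r + r * r * d / (`|x| + 1).
have rs : r < s by rewrite ltrDl divr_gt0 ?mulr_gt0// ltr_wpDl.
exists (s^-1 *: x); split; first exact: Mgt.
apply: dB; rewrite -ball_normE /ball_ /= -scalerBl normrZ.
have s0 := lt_trans r0 rs.
rewrite (_ : r^-1 - s^-1 = (s - r) / (r * s)); last by field; rewrite !gt_eqF.
rewrite gtr0_norm ?divr_gt0 ?subr_gt0 ?mulr_gt0//.
rewrite /s addrAC subrr add0r -/s.
have -> : r * r * d / (`|x| + 1) / (r * s) * `|x| = (r / s) * (`|x| / (`|x| + 1)) * d.
  by field; rewrite ?gt_eqF// ltr_wpDl.
rewrite gtr_pMl//.
have h1 : r / s < 1 by rewrite ltr_pdivrMr// mul1r.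
have h2 : `|x| / (`|x| + 1) < 1 by rewrite ltr_pdivrMr ?mul1r ?ltrDl// ltr_wpDl.
have h3 : 0 < r / s by rewrite divr_gt0.
have h4 : 0 < `|x| / (`|x| + 1) by rewrite divr_gt0// ltr_wpDl.
by nra.
Qed.

Lemma body_norm_ge0 x : 0 <= body_norm M x.
Proof.
(* On the empty set [inf] takes the default value 0. *)
rewrite /body_norm; case: ifP => // _; have [->|/set0P S0] := eqVneq [set mu : R | 0 < mu /\ dilate mu M x] set0.
  by rewrite inf0.
by apply: lb_le_inf => // mu [/ltW].
Qed.

(** [body_norm_leP] speaks of positive radii only, so equalities between norms are tested on
    positive thresholds. *)
Lemma eq_le_pos (a b : R) : 0 <= a -> 0 <= b ->
  (forall r, 0 < r -> (a <= r) <-> (b <= r)) -> a = b.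
Proof.
move=> a0 b0 H; apply/eqP; rewrite eq_le; apply/andP; split; apply/ler_addgt0Pr => e e0.
  by apply/H; [exact: ltr_wpDl|rewrite lerDl ltW].
by apply/H; [exact: ltr_wpDl|rewrite lerDl ltW].
Qed.

Lemma plane_norm_body : plane_norm (body_norm M).
Proof.
have opp x : body_norm M (- x) = body_norm M x.
  apply: eq_le_pos; try exact: body_norm_ge0; move=> r r0; rewrite !body_norm_leP//.
  by rewrite scalerN; split=> /oppM //; rewrite opprK.
split.
- move=> t x; have [->|t0] := eqVneq t 0; first by rewrite scale0r body_norm0 normr0 mul0r.
  have -> : body_norm M (t *: x) = body_norm M (`|t| *: x).
    by case: (ger0P t) => // _; rewrite scaleNr opp.
  have nt : 0 < `|t| by rewrite normr_gt0.
  apply: eq_le_pos; [exact: body_norm_ge0|by rewrite mulr_ge0// body_norm_ge0|] => r r0.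
  rewrite body_norm_leP// mulrC -ler_pdivlMr// body_norm_leP ?divr_gt0//.
  by rewrite scalerA invf_div mulrC.
(* The slack [e / 2] keeps [a] and [b] positive even for zero vectors; then [(x + y) / (a + b)] is a
   convex combination of [x / a] and [y / b]. *)
- move=> x y; apply/ler_addgt0Pr => e e0.
  set a := body_norm M x + e / 2; set b := body_norm M y + e / 2.
  have a0 : 0 < a by rewrite ltr_wpDl ?body_norm_ge0// divr_gt0.
  have b0 : 0 < b by rewrite ltr_wpDl ?body_norm_ge0// divr_gt0.
  have -> : body_norm M x + body_norm M y + e = a + b by rewrite /a /b; field.
  have Mx : M (a^-1 *: x) by apply/body_norm_leP => //; rewrite lerDl divr_ge0// ltW.
  have My : M (b^-1 *: y) by apply/body_norm_leP => //; rewrite lerDl divr_ge0// ltW.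
  clearbody a b; have ab0 : 0 < a + b by exact: addr_gt0.
  apply/body_norm_leP => //.
  have -> : (a + b)^-1 *: (x + y) = (a / (a + b)) *: (a^-1 *: x) + (1 - a / (a + b)) *: (b^-1 *: y).
    by apply: plane_eq; rewrite /= /GRing.scale /=; field; rewrite !gt_eqF.
  apply: convM => //; apply/andP; split; first by rewrite divr_ge0 // ltW.
  by rewrite ler_pdivrMr// mul1r lerDl ltW.
- have [e e0 eM] := ballM; exists (2 / e); first by rewrite divr_gt0.
  move=> x; have [->|x0] := eqVneq x 0; first by rewrite body_norm0 normr0 mulr0.
  have nx : 0 < `|x| by rewrite normr_gt0.
  apply/body_norm_leP; first by rewrite mulr_gt0// divr_gt0.
  apply: eM; rewrite normrZ gtr0_norm ?invr_gt0 ?mulr_gt0 ?invr_gt0//.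
  rewrite (_ : (2 / e * `|x|)^-1 * `|x| = e / 2); last by field; rewrite !gt_eqF.
  by lra.
- have [K K0 KM] := boundM; exists K => // x; have [->|x0] := eqVneq x 0.
    by rewrite normr0 body_norm0 mulr0.
  apply/ler_addgt0Pr => e e0.
  have s0 : 0 < body_norm M x + e / K by rewrite ltr_wpDl ?body_norm_ge0// divr_gt0.
  have : M ((body_norm M x + e / K)^-1 *: x).
    by apply/body_norm_leP => //; rewrite lerDl divr_ge0// ltW.
  move=> /KM; rewrite normrZ gtr0_norm ?invr_gt0// mulrC ler_pdivrMr// mulrDr.
  by rewrite mulrCA divff ?gt_eqF// mulr1.
Qed.

Lemma dilate_body r : 0 < r -> dilate r M = [set x | body_norm M x <= r].
Proof.
by move=> r0; rewrite dilate_preimage//; apply/seteqP; split=> x /=; rewrite body_norm_leP.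
Qed.

Lemma body_norm_ball : M = [set x | body_norm M x <= 1].
Proof. by apply/seteqP; split=> x /=; rewrite body_norm_leP// invr1 scale1r. Qed.

End Body.

Definition euclid x : R := Num.sqrt (x.1 ^+ 2 + x.2 ^+ 2).

Lemma plane_norm_euclid : plane_norm euclid.
Proof.
split.
- by move=> t x; rewrite /euclid /= !exprMn -mulrDr sqrtrM ?sqr_ge0// sqrtr_sqr.
- move=> [a b] [c d]; rewrite /euclid /=.
  set u := Num.sqrt _; set v := Num.sqrt (a ^+ 2 + _); set w := Num.sqrt (c ^+ 2 + _).
  have v0 : 0 <= v by exact: sqrtr_ge0.
  have w0 : 0 <= w by exact: sqrtr_ge0.
  have v2 : v ^+ 2 = a ^+ 2 + b ^+ 2 by rewrite sqr_sqrtr// addr_ge0 ?sqr_ge0.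
  have w2 : w ^+ 2 = c ^+ 2 + d ^+ 2 by rewrite sqr_sqrtr// addr_ge0 ?sqr_ge0.
  rewrite -(@ler_pXn2r _ 2)// ?nnegrE ?addr_ge0 ?sqrtr_ge0//.
  rewrite sqr_sqrtr ?addr_ge0 ?sqr_ge0//.
  suff : a * c + b * d <= v * w by move=> H; rewrite (sqrrD v w) v2 w2; nra.
  apply: le_trans (ler_norm _) _.
  rewrite -(@ler_pXn2r _ 2)// ?nnegrE ?mulr_ge0// exprMn v2 w2 real_normK ?num_real//.
  (* Cauchy-Schwarz by Lagrange's identity: this square is the difference of the two sides. *)
  by have := sqr_ge0 (a * d - b * c); nra.
- exists 2 => // -[a b]; rewrite /euclid /=.
  have -> : `|(a, b)| = Num.max `|a| `|b| :> R by [].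
  have h : 0 <= Num.max `|a| `|b| by rewrite le_max normr_ge0.
  rewrite -(@ler_pXn2r _ 2)// ?nnegrE ?mulr_ge0 ?sqrtr_ge0//.
  rewrite sqr_sqrtr ?addr_ge0 ?sqr_ge0// -(real_normK (num_real a)) -(real_normK (num_real b)) exprMn.
  have := normr_ge0 a; have := normr_ge0 b.
  by case: (leP `|a| `|b|) => ?; nra.
- exists 1 => // -[a b]; rewrite /euclid /= mul1r.
  have -> : `|(a, b)| = Num.max `|a| `|b| :> R by [].
  rewrite ge_max; apply/andP; split; rewrite -sqrtr_sqr ler_wsqrtr//.
    by rewrite lerDl sqr_ge0.
  by rewrite lerDr sqr_ge0.
Qed.

Lemma dilate_unit_disk r : 0 < r -> dilate r unit_disk = [set x | euclid x <= r].
Proof.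
move=> r0; have r20 : 0 < r ^+ 2 by exact: exprn_gt0.
rewrite dilate_preimage//; apply/seteqP.
have key x : (euclid x <= r) = ((r^-1 *: x).1 ^+ 2 + (r^-1 *: x).2 ^+ 2 <= 1).
  rewrite /euclid -(@ler_pXn2r _ 2)// ?nnegrE ?sqrtr_ge0 ?(ltW r0)// sqr_sqrtr ?addr_ge0 ?sqr_ge0//.
  by rewrite !exprMn -mulrDr exprVn mulrC ler_pdivrMr ?mul1r.
by split=> x /=; rewrite /unit_disk key.
Qed.

End Gauge.

(** * Continuity, measurability and boundedness of norm balls *)

Section NormFacts.
Context {R : realType}.
Implicit Types (x y : R * R).
Variable N : R * R -> R.
Hypothesis hN : plane_norm N.
Notation plane := (measurableTypeR R * measurableTypeR R)%type.

Lemma plane_normN x : N (- x) = N x.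
Proof. by rewrite -scaleN1r (plane_normZ hN) normrN1 mul1r. Qed.

Lemma plane_norm0 : N 0 = 0.
Proof. by rewrite -(scale0r 0) (plane_normZ hN) normr0 mul0r. Qed.

Lemma plane_norm_ge0 x : 0 <= N x.
Proof.
have [a a0 /(_ x) H] := plane_norm_lower hN.
by rewrite -(pmulr_rge0 _ a0) (le_trans _ H).
Qed.

Lemma plane_normB x y : N (x - y) = N (y - x).
Proof. by rewrite -opprB plane_normN. Qed.

Lemma plane_norm_continuous : continuous N.
Proof.
have [b b0 Nb] := plane_norm_upper hN.
have lip x y : N x - N y <= b * `|x - y|.
  by rewrite lerBlDr (le_trans _ (lerD (Nb _) (lexx _)))// -{1}(subrK y x) (plane_normD hN).
move=> x; apply/cvgrPdist_le => e e0; near=> y.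
have : `|x - y| <= e / b by near: y; apply: cvgr_dist_le => //; rewrite divr_gt0.
rewrite ler_pdivlMr// mulrC => H; rewrite ler_norml lerBlDr; apply/andP; split.
  by rewrite lerNl opprB (le_trans (lip _ _))// distrC.
by rewrite -lerBlDr (le_trans (lip _ _)).
Unshelve. all: by end_near. Qed.

Lemma measurable_norm_le (r : R) : measurable ([set x | N x <= r] : set plane).
Proof.
apply: closed_measurable_plane; apply: (@closed_comp _ _ N [set t | t <= r]).
  by move=> x _; exact: plane_norm_continuous.
exact: closed_le.
Qed.

Lemma measurable_norm_lt (r : R) : measurable ([set x | N x < r] : set plane).
Proof.
apply: open_measurable_plane; apply: (@open_comp _ _ N [set t | t < r]).
  by move=> x _; exact: plane_norm_continuous.
exact: open_lt.
Qed.

Lemma area_bounded_lty (A : set plane) (K : R) : measurable A ->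
  (forall x, A x -> `|x| <= K) -> (area A < +oo)%E.
Proof.
move=> mA AK; have mI : measurable (`[- K, K]%classic : set (measurableTypeR R)) by exact: measurable_itv.
apply: (@le_lt_trans _ _ (area (`[(- K)%R, K]%classic `*` `[(- K)%R, K]%classic))).
  apply: area_measure_subset => //; first exact: measurableX.
  move=> [x y] /AK; have -> : `|(x, y)| = Num.max `|x| `|y| :> R by [].
  by rewrite ge_max !ler_norml => /andP[xK yK]; split; rewrite /= in_itv.
rewrite /area product_measure1E//.
have h : (@lebesgue_measure R `[(- K)%R, K]%classic < +oo)%E.
  by rewrite lebesgue_measure_itv /=; case: ifP => // _; rewrite -EFinD ltry.
by apply: lte_mul_pinfty => //; rewrite ge0_fin_numE.
Qed.

Lemma area_ball_gt0 (e : R) : 0 < e -> (0 < area [set x : R * R | (`|x| < e)%R])%E.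
Proof.
move=> e0; have mI : measurable (`]- e, e[%classic : set (measurableTypeR R)) by exact: measurable_itv.
have -> : [set x : R * R | `|x| < e] = `]- e, e[%classic `*` `]- e, e[%classic.
  apply/seteqP; split=> -[x y] /=; have -> : `|(x, y)| = Num.max `|x| `|y| :> R by [].
    by rewrite gt_max !ltr_norml => /andP[xK yK]; split; rewrite /= in_itv.
  by rewrite gt_max !ltr_norml !in_itv /= => -[-> ->].
have h : (0 < @lebesgue_measure R `](- e)%R, e[%classic)%E.
  rewrite lebesgue_measure_itv /= lte_fin.
  have ee : - e < e by lra.
  by rewrite ee -EFinD lte_fin; lra.
by rewrite /area product_measure1E//; exact: mule_gt0.
Qed.

Lemma norm_le_bounded r : exists K, forall x, N x <= r -> `|x| <= K.
Proof.
have [a a0 aN] := plane_norm_lower hN; exists (a * r) => y Ny.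
by rewrite (le_trans (aN y))// ler_pM2l.
Qed.

Lemma norm_ball_subset r : 0 < r -> exists2 e, 0 < e & forall x, `|x| < e -> N x < r.
Proof.
move=> r0; have [b b0 bN] := plane_norm_upper hN; exists (r / b); first by rewrite divr_gt0.
by move=> x; rewrite ltr_pdivlMr// mulrC; apply: le_lt_trans.
Qed.

End NormFacts.

(** * Planar lattices *)

Section Lattice.
Context {R : realType}.
Implicit Types (x y b c : R * R) (L : set (R * R)).
Notation plane := (measurableTypeR R * measurableTypeR R)%type.

(** The determinant of two vectors; [cross p] is, up to a factor, the height over the line through
    [p]. *)
Definition cross x y : R := x.1 * y.2 - x.2 * y.1.

Lemma cross_neq0 b1 b2 : linearly_independent b1 b2 -> cross b1 b2 != 0.
Proof.
move=> ind; apply/eqP => c0.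
have [] := ind b2.2 (- b1.2).
  by apply: plane_eq; move: c0; rewrite /cross /= /GRing.scale /= => c0; lra.
move=> b22 /eqP; rewrite oppr_eq0 => /eqP b12.
have [] := ind b2.1 (- b1.1).
  by apply: plane_eq; move: c0; rewrite /cross /= /GRing.scale /= => c0; lra.
move=> b21 /eqP; rewrite oppr_eq0 => /eqP b11.
have [] := ind 1 0.
  by apply: plane_eq; rewrite /= /GRing.scale /= ?b11 ?b12; lra.
by move=> /eqP; rewrite oner_eq0.
Qed.

Lemma cramer b1 b2 x : cross b1 b2 != 0 ->
  x = (cross x b2 / cross b1 b2) *: b1 + (cross b1 x / cross b1 b2) *: b2.
Proof.
by move=> c0; apply: plane_eq; move: c0; rewrite /cross /= /GRing.scale /= => c0; field.
Qed.

Lemma floor_frac (u : R) : 0 <= u - (Num.floor u)%:~R < 1.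
Proof.
have /andP[] := real_floor_itv (num_real u).
by rewrite subr_ge0 ltrBlDl intrD addrC => -> ->.
Qed.

(** A basis-free list of what is used of a full-rank lattice: subgroup, countable, locally finite,
    relatively dense. *)
Record lattice L : Prop := Lattice {
  lattice0 : L 0;
  latticeB : forall x y, L x -> L y -> L (x - y);
  lattice_countable : exists f : int * int -> R * R, L = range f;
  lattice_finite : forall r : R, finite_set (L `&` [set x | `|x| <= r]);
  lattice_dense : exists r : R, forall x, exists2 c, L c & `|x - c| <= r }.

Lemma latticeN L x : lattice L -> L x -> L (- x).
Proof. by move=> hL Lx; rewrite -sub0r; apply: (latticeB hL) => //; exact: lattice0. Qed.

Lemma latticeD L x y : lattice L -> L x -> L y -> L (x + y).
Proof. by move=> hL Lx Ly; rewrite -(opprK y); apply: (latticeB hL) => //; exact: latticeN. Qed.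

Lemma finite_int (r : R) : finite_set [set z : int | `|z%:~R| <= r].
Proof.
pose g (k : bool * nat) : int := if k.1 then k.2%:Z else - k.2%:Z.
apply: (@sub_finite_set _ _ (g @` ([set: bool] `*` `I_(Num.truncn r).+1))).
  move=> z /= zr; exists (0 <= z, absz z); last by rewrite /g /=; case: ifP; lia.
  split => //=; have r0 : 0 <= r by rewrite (le_trans _ zr).
  by rewrite ltnS truncn_ge_nat// -[X in X <= _]/((absz z)%:Z%:~R) abszE intr_norm.
apply/finite_image/finite_setX => //; exact: finite_II.
Qed.

Lemma lattice_full_rank L : full_rank_lattice L -> lattice L.
Proof.
move=> [b1 [b2 [ind ->]]]; have c0 := cross_neq0 ind.
pose f (m : int * int) := b1 *~ m.1 + b2 *~ m.2.
have fE m : f m = m.1%:~R *: b1 + m.2%:~R *: b2 by rewrite /f !scaler_int.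
split.
- by exists (0, 0); rewrite //= !mulr0z addr0.
- by move=> _ _ [m _ <-] [n _ <-]; exists (m - n) => //; rewrite /= !mulrzBr opprD addrACA.
- by exists f.
- move=> r.
  (* By Cramer's rule the integer coordinates of [f m] are quotients of determinants, and
     [|cross x y| <= 2 * |x| * |y|] bounds them by [K]. *)
  pose K := (`|r| * 2 * (`|b1| + `|b2|)) / `|cross b1 b2|.
  apply: (@sub_finite_set _ _ (f @` ([set z : int | `|z%:~R| <= K] `*` [set z : int | `|z%:~R| <= K]))).
    move=> _ [[m _ <-]] /= fr; exists m => //.
    have cr x y : `|cross x y| <= 2 * `|x| * `|y|.
      have -> : `|x| = Num.max `|x.1| `|x.2| :> R by [].
      have -> : `|y| = Num.max `|y.1| `|y.2| :> R by [].
      rewrite /cross (le_trans (ler_normB _ _))// !normrM mulr2n !mulrDl !mul1r lerD//;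
        by apply: ler_pM => //; rewrite le_max lexx ?orbT.
    have m1 : m.1%:~R = cross (f m) b2 / cross b1 b2.
      by rewrite fE; move: c0; rewrite /cross /= /GRing.scale /= => ?; field.
    have m2 : m.2%:~R = cross b1 (f m) / cross b1 b2.
      by rewrite fE; move: c0; rewrite /cross /= /GRing.scale /= => ?; field.
    have rr : `|f m| <= `|r| by rewrite (le_trans fr)// ler_norm.
    have := normr_ge0 b1; have := normr_ge0 b2; have := normr_ge0 (f m) => *.
    split; rewrite /= ?m1 ?m2 /K normrM normfV ler_pM2r ?invr_gt0 ?normr_gt0// (le_trans (cr _ _))//; nra.
  by apply/finite_image/finite_setX; exact: finite_int.
(* Rounding down both coordinates of [x] leaves a remainder with coordinates in [[0, 1)]. *)
- exists (`|b1| + `|b2|) => x.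
  pose s := cross x b2 / cross b1 b2; pose t := cross b1 x / cross b1 b2.
  exists (f (Num.floor s, Num.floor t)); first by exists (Num.floor s, Num.floor t).
  have -> : x - f (Num.floor s, Num.floor t) = (s - (Num.floor s)%:~R) *: b1 + (t - (Num.floor t)%:~R) *: b2.
    rewrite {1}(cramer x c0) fE /= !scalerBl -/s -/t.
    by apply: plane_eq; rewrite /= /GRing.scale /=; ring.
  have fr (u : R) : `|u - (Num.floor u)%:~R| <= 1.
    by have /andP[u0 u1] := floor_frac u; rewrite ger0_norm// ltW.
  rewrite (le_trans (ler_normD _ _))// !normrZ lerD// ler_piMl//.
Qed.

End Lattice.

(** * Unions over a lattice, packing sets and periodic sets *)

Section LatticeSets.
Context {R : realType}.
Notation plane := (measurableTypeR R * measurableTypeR R)%type.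
Implicit Types (x y c d : R * R) (L A D V X Y : set (R * R)).

Lemma lattice_bigcup_measurable L (F : R * R -> set plane) : lattice L ->
  (forall c, L c -> measurable (F c)) -> measurable (\bigcup_(c in L) F c).
Proof.
move=> hL mF; have [f Lf] := lattice_countable hL.
rewrite Lf bigcup_image; apply: countable_bigcupT_measurable => // m.
by apply: mF; rewrite Lf; exists m.
Qed.

Lemma lattice_bigcap_measurable L (F : R * R -> set plane) : lattice L ->
  (forall c, L c -> measurable (F c)) -> measurable (\bigcap_(c in L) F c).
Proof.
move=> hL mF; rewrite -[X in measurable X]setCK setC_bigcap; apply: measurableC.
by apply: lattice_bigcup_measurable => // c Lc; apply: measurableC; exact: mF.
Qed.

Lemma finite_set_min (T : choiceType) (F : set T) (f : T -> R) : finite_set F -> F !=set0 ->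
  exists2 c, F c & forall d : T, F d -> f c <= f d.
Proof.
move=> /finite_seqP[s ->]; elim: s => [[x]//|a s ih] _.
case: s ih => [_|b s ih].
  by exists a => [|d]; rewrite /= inE// => /eqP ->.
have [|c cs cmin] := ih; first by exists b; rewrite /= inE eqxx.
have [ac|ca] := leP (f a) (f c).
  exists a; first by rewrite /= inE eqxx.
  move=> d; rewrite /= inE => /orP[/eqP -> //|ds].
  by rewrite (le_trans ac)// cmin.
exists c; first by rewrite /= inE; apply/orP; right.
move=> d; rewrite /= inE => /orP[/eqP ->|ds]; [exact: ltW|exact: cmin].
Qed.

Lemma translateE c A x : translate c A x <-> A (x - c).
Proof.
split; first by case=> y Ay <-; rewrite addrAC subrr add0r.
by move=> Ax; exists (x - c) => //; rewrite addrC subrK.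
Qed.

(** Disjointness is exact, boundaries included, so that areas of translates add up. Cells are
    therefore taken half-open, and unit balls open. *)
Definition packs L D := forall c d x, L c -> L d -> translate c D x -> translate d D x -> c = d.

Definition periodic L A := forall c x, L c -> A x -> A (x + c).

Lemma packs_trivIset L D F : packs L D -> F `<=` L -> trivIset F (fun c => translate c D).
Proof.
move=> pD FL; apply/trivIsetP => c d Fc Fd; apply: contra_neqP => /eqP/set0P[x [cx dx]].
by apply: pD cx dx; exact: FL.
Qed.

End LatticeSets.

(** * Voronoi cells with respect to a norm *)

Section Voronoi.
Context {R : realType}.
Notation plane := (measurableTypeR R * measurableTypeR R)%type.
Implicit Types (x y w c d : R * R) (L A D V X Y : set (R * R)).
Variable N : R * R -> R.
Hypothesis hN : plane_norm N.

(** Lexicographic positivity, used to break ties: of [d] and [- d], at most one has it. *)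
Definition lexpos d : Prop := 0 < d.1 \/ d.1 = 0 /\ 0 < d.2.

Lemma lexpos_asym d : lexpos d -> lexpos (- d) -> False.
Proof. by rewrite /lexpos /= => -[?|[? ?]] [?|[? ?]]; lra. Qed.

(** A tie goes to the lexicographically smallest nearest lattice point. This makes the cells an
    exact tiling even if [N] is not strictly convex, when bisectors may have positive area. *)
Definition voronoi L := [set w | forall d, L d -> d != 0 ->
  N w < N (w - d) \/ (N w = N (w - d) /\ lexpos d)].

(** The condition imposed by one [d] is closed if [lexpos d] holds and open otherwise, and there are
    countably many conditions. *)
Lemma measurable_voronoi L : lattice L -> measurable (voronoi L : set plane).
Proof.
move=> hL; pose F d := [set w | d != 0 -> N w < N (w - d) \/ (N w = N (w - d) /\ lexpos d)].
have -> : voronoi L = \bigcap_(d in L) F d by apply/seteqP; split=> w H d; apply: H.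
apply: lattice_bigcap_measurable => // d _; rewrite /F.
have [->|d0] := eqVneq d 0.
  by rewrite (_ : [set _ | _] = setT)//; apply/seteqP; split=> w.
have cN := plane_norm_continuous hN.
have cg : continuous (fun w => N (w - d) - N w).
  move=> w; apply: cvgB; last exact: cN.
  apply: continuous_comp; last exact: cN.
  by apply: cvgB; [exact: cvg_id|exact: cvg_cst].
have [lp|nlp] := pselect (lexpos d).
  rewrite (_ : [set _ | _] = (fun w => N (w - d) - N w) @^-1` [set t | 0 <= t]).
    apply: closed_measurable_plane; apply: closed_comp; last exact: closed_ge.
    by move=> x _; exact: cg.
  apply/seteqP; split=> w /=; rewrite subr_ge0.
    by move=> /(_ isT)[/ltW //|[-> _]].
  by rewrite le_eqVlt => /orP[/eqP H|H] _; [right|left].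
rewrite (_ : [set _ | _] = (fun w => N (w - d) - N w) @^-1` [set t | 0 < t]).
  apply: open_measurable_plane; apply: open_comp; last exact: open_gt.
  by move=> x _; exact: cg.
apply/seteqP; split=> w /=; rewrite subr_gt0; last by left.
by move=> /(_ isT)[//|[]].
Qed.

(** A point common to two cells is tied between their centers, and then both differences of the
    centers would be lexicographically positive. *)
Lemma voronoi_packs L : lattice L -> packs L (voronoi L).
Proof.
move=> hL c d x Lc Ld /translateE cx /translateE dx; apply: contrapT => /eqP cd.
have := cx (d - c) (latticeB hL Ld Lc); rewrite subr_eq0 eq_sym => /(_ cd).
have := dx (c - d) (latticeB hL Lc Ld); rewrite subr_eq0 => /(_ cd).
have -> : x - d - (c - d) = x - c by rewrite opprB addrA subrK.
have -> : x - c - (d - c) = x - d by rewrite opprB addrA subrK.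
move=> [h1|[h1 l1]] [h2|[h2 l2]]; try lra.
by apply: (lexpos_asym l1); rewrite opprB.
Qed.

(** The center is found by three minimisations over finite sets: the distance to [x], then the first
    coordinate, then the second. *)
Lemma voronoi_cover L x : lattice L -> exists2 c, L c & translate c (voronoi L) x.
Proof.
move=> hL; have [r /(_ x)[c0 Lc0 c0r]] := lattice_dense hL.
have [b b0 Nb] := plane_norm_upper hN; have [a a0 Na] := plane_norm_lower hN.
pose F := L `&` [set c | N (x - c) <= N (x - c0)].
have finF : finite_set F.
  apply: (sub_finite_set _ (lattice_finite hL (a * N (x - c0) + `|x|))) => c [Lc /= Nc].
  split=> //=; rewrite -(subKr x c) -opprB normrN (le_trans (ler_normB _ _))// lerD2r.
  by rewrite (le_trans (Na _))// ler_pM2l.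
have [c1 F1 min1] := finite_set_min (fun c => N (x - c)) finF (ex_intro _ c0 (conj Lc0 (lexx _))).
pose G := F `&` [set c | N (x - c) = N (x - c1)].
have finG : finite_set G by apply: sub_finite_set finF => c [].
have [c2 G2 min2] := finite_set_min (fun c => c.1) finG (ex_intro _ c1 (conj F1 erefl)).
pose H := G `&` [set c | c.1 = c2.1].
have finH : finite_set H by apply: sub_finite_set finG => c [].
have [c [[[Lc Fc] Gc] Hc] min3] := finite_set_min (fun c => c.2) finH (ex_intro _ c2 (conj G2 erefl)).
exists c => //; apply/translateE => d Ld d0.
rewrite /= in Fc Gc Hc.
rewrite -addrA -opprD.
have Lcd : L (c + d) by exact: latticeD.
have [cd|cd] := ltP (N (x - c)) (N (x - (c + d))); first by left.
right.
have Fcd : F (c + d) by split=> //=; rewrite (le_trans cd).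
have Ncd : N (x - c) = N (x - (c + d)).
  by apply/eqP; rewrite eq_le cd andbT Gc; exact: min1.
split=> //.
have Gcd : G (c + d) by split=> //=; rewrite -Ncd.
have := min2 _ Gcd; rewrite /= -Hc lerDl le_eqVlt => /orP[/eqP d1|]; last by left.
right; split=> //.
have Hcd : H (c + d) by split=> //=; rewrite -d1 addr0.
have := min3 _ Hcd; rewrite /= lerDl le_eqVlt => /orP[/eqP d2|//].
by exfalso; move/eqP: d0; apply; apply: plane_eq; rewrite /= -?d1 -?d2.
Qed.

Lemma voronoi_bounded L : lattice L -> exists K, forall w, voronoi L w -> `|w| <= K.
Proof.
move=> hL; have [r dr] := lattice_dense hL.
have [b b0 Nb] := plane_norm_upper hN; have [a a0 Na] := plane_norm_lower hN.
exists (a * (b * r)) => w Vw; rewrite (le_trans (Na _))// ler_pM2l//.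
have [c Lc cr] := dr w; have H : N (w - c) <= b * r by rewrite (le_trans (Nb _))// ler_pM2l.
have [c0|c0] := eqVneq c 0; first by rewrite c0 subr0 in H.
rewrite (le_trans _ H)//; have [/ltW//|[-> _]//] := Vw c Lc c0.
Qed.

(* By convexity, t |-> N (w - t d) does not decrease from 1 to a once it does not
   decrease from 0 to 1. *)
Lemma voronoi_scale L (a : R) : 1 <= a -> voronoi L `<=` voronoi (dilate a L).
Proof.
move=> a1 w Vw _ [d Ld <-] ad0.
have a0 : 0 < a by lra.
have d0 : d != 0 by apply: contraNneq ad0 => ->; rewrite scaler0.
have : a * N (w - d) <= (a - 1) * N w + N (w - a *: d).
  have -> : a * N (w - d) = N (a *: (w - d)) by rewrite (plane_normZ hN) gtr0_norm.
  have -> : (a - 1) * N w = N ((a - 1) *: w) by rewrite (plane_normZ hN) ger0_norm ?subr_ge0.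
  rewrite (_ : a *: (w - d) = (a - 1) *: w + (w - a *: d)) ?(plane_normD hN)//.
  by apply: plane_eq; rewrite /= /GRing.scale /=; ring.
move=> H; have [lt|[eq lp]] := Vw d Ld d0; first by left; nra.
have : N w <= N (w - a *: d) by rewrite eq in H *; lra.
rewrite le_eqVlt => /orP[/eqP ->|]; last by left.
right; split=> //; case: lp => [lp|[d1 d2]]; [left|right].
  by rewrite /= /GRing.scale /= mulr_gt0.
by rewrite /= /GRing.scale /= d1 mulr0 mulr_gt0.
Qed.

(** Here [N (w - d) >= 2 - N w > 1 > N w], so no tie occurs. Hence open unit balls inherit
    disjointness from the cells. *)
Lemma ball_sub_voronoi L : (forall d, L d -> d != 0 -> 2 <= N d) ->
  [set x | N x < 1] `<=` voronoi L.
Proof.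
move=> pL w /= w1 d Ld d0; left; have := pL d Ld d0.
have : N d <= N (w - d) + N w by rewrite -(plane_normB hN d) -{1}(subrK w d) (plane_normD hN).
by move=> *; lra.
Qed.

End Voronoi.

(** * Area comparison and lattice point counts in large disks *)

Section Counting.
Context {R : realType}.
Notation plane := (measurableTypeR R * measurableTypeR R)%type.
Implicit Types (x y w c d : R * R) (L A D V X Y : set (R * R)).
Notation mu := ((@lebesgue_measure R) \x (@lebesgue_measure R))%E.

Lemma fsum_cst (F : set (R * R)) (a : \bar R) : finite_set F ->
  (\sum_(c \in F) a = (#|` fset_set F|%:R)%:E * a)%E.
Proof.
move=> fF; rewrite fsbig_finite//= big_const_seq count_predT.
elim: (size _) => [|n ih]; first by rewrite mul0e.
by rewrite iterS ih -natr1 EFinD ge0_muleDl ?lee_fin// mul1e addeC.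
Qed.

Lemma area_bigcup_packs (L F : set (R * R)) (D : set plane) : finite_set F -> F `<=` L ->
  packs L D -> measurable D ->
  area (\bigcup_(c in F) translate c D) = ((#|` fset_set F|%:R)%:E * area D)%E.
Proof.
move=> fF FL pD mD; rewrite -fsum_cst//.
rewrite [LHS](@measure_fin_bigcup _ _ _ mu _ F (fun c => translate c D))//.
- by apply: eq_fsbigr => c _; rewrite -[LHS]/(area _) area_translate.
- exact: packs_trivIset pD FL.
- by move=> c _; exact: measurable_translate.
Qed.

Lemma area_bigcup_le (F : set (R * R)) (D A : set plane) : finite_set F ->
  measurable D -> measurable A -> A `<=` \bigcup_(c in F) translate c D ->
  (area A <= (#|` fset_set F|%:R)%:E * area D)%E.
Proof.
move=> fF mD mA AD; rewrite -fsum_cst//.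
apply: le_trans (@content_sub_fsum _ _ _ mu _ F A (fun c => translate c D) fF _ mA AD) _.
  by move=> c _; exact: measurable_translate.
by rewrite (eq_fsbigr (fun=> area D))// => c _; rewrite -[LHS]/(area _) area_translate.
Qed.

(** Cut [D] along the translates of [V] and move the piece in [c + V] by [- c]. The pieces land in
    [V], stay in the periodic set [A], and remain disjoint because [D] packs. *)
Lemma area_packs_le_cover L (A D V : set plane) : lattice L ->
  measurable A -> measurable D -> measurable V -> periodic L A -> D `<=` A ->
  packs L D -> (forall x, exists2 c, L c & translate c V x) ->
  (exists K, forall x, D x -> `|x| <= K) -> (exists K, forall x, V x -> `|x| <= K) ->
  (area D <= area (V `&` A))%E.
Proof.
move=> hL mA mD mV pA DA pD cV [KD bD] [KV bV].
(* Only these finitely many translates of [V] can meet [D]. *)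
pose F := L `&` [set c | `|c| <= KD + KV].
have fF : finite_set F := lattice_finite hL (KD + KV).
pose E c := D `&` translate c V.
have mE c : measurable (E c : set plane).
  by apply: measurableI => //; exact: measurable_translate.
apply: le_trans (@content_sub_fsum _ _ _ mu _ F D E fF _ mD _) _.
- by move=> c _; exact: mE.
- move=> x Dx; have [c Lc cx] := cV x; exists c => //; split=> //=.
  move/translateE : cx => /bV cx.
  by rewrite -(subKr x c) (le_trans (ler_normB _ _))// lerD// bD.
have tE c : area (E c) = area (translate (- c) (E c)) by rewrite area_translate.
rewrite (eq_fsbigr (fun c => area (translate (- c) (E c)))); last by move=> c _; rewrite -tE.
rewrite -(@measure_fin_bigcup _ _ _ mu _ F (fun c => translate (- c) (E c)))//.
- apply: area_measure_subset.
  + apply: fin_bigcup_measurable => // c _; exact: measurable_translate.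
  + exact: measurableI.
  + move=> x [c [Lc _] /translateE]; rewrite opprK => -[Dx /translateE].
    rewrite addrK => Vx; split=> //.
    by rewrite -(addrK c x); apply: pA; [exact: latticeN|exact: DA].
- apply/trivIsetP => c d [Lc _] [Ld _]; apply: contra_neqP => /eqP/set0P[x [/translateE + /translateE]].
  rewrite !opprK => -[Dc _] [Dd _].
  apply: oppr_inj; apply: (pD _ _ x); try exact: latticeN.
    by apply/translateE; rewrite opprK.
  by apply/translateE; rewrite opprK.
- by move=> c _; exact: measurable_translate.
Qed.

Variable E : R * R -> R.
Hypothesis hE : plane_norm E.
Variable L : set (R * R).
Hypothesis hL : lattice L.

(** Used at two norms: the Euclidean one for the large windows, and the norm of [M] for the balls of
    the packing. *)
Definition disk r := [set x | E x <= r].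

Definition lattice_count (r : R) : nat := #|` fset_set (L `&` disk r)|.

Lemma finite_disk r : finite_set (L `&` disk r).
Proof.
have [K KE] := norm_le_bounded hE r; apply: sub_finite_set (lattice_finite hL K).
by move=> c [Lc /= /KE].
Qed.

Lemma measurable_disk r : measurable (disk r : set plane).
Proof. exact: measurable_norm_le. Qed.

(** A translate of [X] that meets the disk of radius [r] has its center within [r + rho]. *)
Lemma disk_cover_le (X A : set plane) rho r : measurable X -> measurable A ->
  X `<=` disk rho -> A `<=` \bigcup_(c in L) translate c X ->
  (area (A `&` disk r) <= (lattice_count (r + rho))%:R%:E * area X)%E.
Proof.
move=> mX mA Xr AX; apply: area_bigcup_le => //.
- exact: finite_disk.
- by apply: measurableI => //; exact: measurable_disk.
move=> x [/AX [c Lc cx] Ex]; exists c => //; split=> //=; rewrite /disk /=.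
move/translateE : cx => /Xr /=; rewrite /disk /= => cx.
rewrite -(subKr x c) (le_trans (plane_normD hE _ _))// plane_normN// lerD//.
Qed.

(** A translate of [Y] with center within [r - rho] lies entirely in the disk of radius [r]. *)
Lemma disk_packs_ge (Y A : set plane) rho r : measurable Y -> measurable A ->
  Y `<=` disk rho -> packs L Y -> Y `<=` A -> periodic L A ->
  ((lattice_count (r - rho))%:R%:E * area Y <= area (A `&` disk r))%E.
Proof.
move=> mY mA Yr pY YA pA; rewrite -(area_bigcup_packs (finite_disk _) _ pY mY)//.
apply: area_measure_subset.
- apply: fin_bigcup_measurable; first exact: finite_disk.
  by move=> c _; exact: measurable_translate.
- by apply: measurableI => //; exact: measurable_disk.
move=> x [c [Lc /= cr] [y Yy <-]]; split; first by rewrite addrC; apply: pA => //; exact: YA.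
rewrite /disk /=; rewrite (le_trans (plane_normD hE _ _))//.
by have := Yr y Yy; move: cr; rewrite /disk /= => *; lra.
Qed.

Lemma area_disk r : 0 < r -> area (disk r) = ((r ^+ 2)%:E * area (disk 1%R))%E.
Proof.
move=> r0; rewrite -area_dilate//; last exact: measurable_disk.
congr area; rewrite dilate_preimage//; apply/seteqP; split=> x; rewrite /disk /=;
  by rewrite (plane_normZ hE) gtr0_norm ?invr_gt0// mulrC ler_pdivrMr// mul1r.
Qed.

Lemma area_disk1 : exists2 e : R, 0 < e & area (disk 1) = e%:E.
Proof.
have [K KE] := norm_le_bounded hE 1.
have fin := area_bounded_lty (measurable_disk 1) KE.
have [e e0 eE] := norm_ball_subset hE (@ltr01 R).
have pos : (0 < area (disk 1%R))%E.
  apply: lt_le_trans (area_ball_gt0 e0) _; apply: area_measure_subset.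
  - apply: open_measurable_plane.
    by apply: (@open_comp _ _ (fun x : R * R => `|x|) [set t | t < e]) => [x _|];
      [exact: norm_continuous|exact: open_lt].
  - exact: measurable_disk.
  - by move=> x /= /eE /ltW.
exists (fine (area (disk 1))); last by rewrite fineK// ge0_fin_numE// ltW.
by apply: fine_gt0; rewrite pos.
Qed.

(** If [D] had area 0, finitely many of its translates would still cover the unit disk, which has
    positive area. *)
Lemma cell_area (D : set plane) rho : measurable D -> D `<=` disk rho ->
  (forall x, exists2 c, L c & translate c D x) ->
  exists2 delta : R, 0 < delta & area D = delta%:E.
Proof.
move=> mD Dr cD.
have [K KE] := norm_le_bounded hE rho.
have fin : (area D < +oo)%E by apply: (@area_bounded_lty _ D K mD) => x /Dr /KE.
have [e e0 eE] := area_disk1.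
have := @disk_cover_le D setT rho 1 mD measurableT Dr.
rewrite setTI eE => /(_ _)/wrap[x _|H].
  by have [c Lc cx] := cD x; exists c.
have D0 : (0 < area D)%E.
  rewrite lt_neqAle measure_ge0 andbT; apply/eqP => D0; move: H.
  by rewrite -D0 mule0 lee_fin; lra.
exists (fine (area D)); first by apply: fine_gt0; rewrite D0.
by rewrite fineK// ge0_fin_numE// ltW.
Qed.

(** A tile both packs and covers. The two estimates are applied at radii [r + 2 * rho] and
    [r - 2 * rho], so that the counts appear at [r + rho] and [r - rho], as needed for the
    densities. *)
Lemma lattice_count_bounds (D : set plane) rho delta e r :
  measurable D -> D `<=` disk rho ->
  packs L D -> (forall x, exists2 c, L c & translate c D x) ->
  area D = delta%:E -> area (disk 1) = e%:E -> 0 <= rho -> 2 * rho < r ->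
  (lattice_count (r + rho))%:R * delta <= (r + 2 * rho) ^+ 2 * e /\
  (r - 2 * rho) ^+ 2 * e <= (lattice_count (r - rho))%:R * delta.
Proof.
move=> mD Dr pD cD aD ae rho0 rr; split.
  have := @disk_packs_ge D setT rho (r + 2 * rho) mD measurableT Dr pD (@subsetT _ _) (fun _ _ _ _ => I).
  rewrite setTI aD area_disk ?ae; last by lra.
  by rewrite (_ : r + 2 * rho - rho = r + rho); [rewrite -!EFinM lee_fin|ring].
have := @disk_cover_le D setT rho (r - 2 * rho) mD measurableT Dr.
rewrite setTI aD area_disk ?ae; last by lra.
rewrite (_ : r - 2 * rho + rho = r - rho); [rewrite -!EFinM lee_fin; apply|ring].
by move=> x _; have [c Lc cx] := cD x; exists c.
Qed.

End Counting.

(** * Upper limits at infinity from eventual bounds *)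

Section LimSup.
Context {R : realType}.
Local Open Scope ereal_scope.

Lemma limf_esup_le (f : R -> \bar R) (k : R) :
  (forall k', (k < k')%R -> exists r0, forall r, (r0 < r)%R -> f r <= k'%:E) ->
  limf_esup f (+oo%R : set_system R) <= k%:E.
Proof.
move=> H; apply/lee_addgt0Pr => e e0.
have [r0 fr] := H (k + e)%R (ltac:(by rewrite ltrDl)).
apply: (@le_trans _ _ (ereal_sup (f @` [set r | (r0 < r)%R]))).
  apply: ereal_inf_lbound; exists [set r | (r0 < r)%R] => //=.
  by exists r0; split; [exact: num_real|].
by apply: ge_ereal_sup => _ [r /fr fr' <-]; rewrite -EFinD.
Qed.

Lemma limf_esup_ge (f : R -> \bar R) (k : R) :
  (forall k', (k' < k)%R -> exists r0, forall r, (r0 < r)%R -> k'%:E <= f r) ->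
  k%:E <= limf_esup f (+oo%R : set_system R).
Proof.
move=> H; apply/lee_subgt0Pr => e e0.
have [r0 fr] := H (k - e)%R (ltac:(by rewrite ltrBlDr ltrDl)).
apply: le_ereal_inf_tmp => _ [A [r1 [_ rA]] <-].
(* A point beyond both thresholds: it satisfies the bound and lies in the given neighbourhood of
   infinity. *)
apply: (@le_trans _ _ (f (Num.max r0 r1 + 1))%R).
  by rewrite -EFinB; apply: fr; rewrite ltr_pwDr// le_max lexx.
apply: le_ereal_sup_tmp; exists (f (Num.max r0 r1 + 1)%R) => //.
by exists (Num.max r0 r1 + 1)%R => //; apply: rA; rewrite ltr_pwDr// le_max lexx orbT.
Qed.

Lemma le_limf_esup (f g : R -> \bar R) :
  (forall r, (0 < r)%R -> f r <= g r) ->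
  limf_esup f (+oo%R : set_system R) <= limf_esup g (+oo%R : set_system R).
Proof.
move=> fg; apply: le_ereal_inf_tmp => _ [A [r1 [_ rA]] <-].
apply: (@le_trans _ _ (ereal_sup (f @` [set r | (Num.max 0 r1 < r)%R]))).
  apply: ereal_inf_lbound; exists [set r | (Num.max 0 r1 < r)%R] => //.
  by exists (Num.max 0 r1)%R; split; [exact: num_real|].
apply: ge_ereal_sup => _ [r /= rr <-]; move: rr; rewrite gt_max => /andP[r0 r1r].
rewrite (le_trans (fg r r0))//; apply: le_ereal_sup_tmp; exists (g r) => //.
by exists r => //; exact: rA.
Qed.

End LimSup.

(** * The lens apex and the lattice it spans *)

Section CriticalLattice.
Context {R : realType}.
Notation plane := (measurableTypeR R * measurableTypeR R)%type.
Implicit Types (x y w c d p q z : R * R) (L A D V X Y : set (R * R)).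
Variable N : R * R -> R.
Hypothesis hN : plane_norm N.

Lemma cross_continuous p : continuous (cross p).
Proof.
move=> x; rewrite /cross; apply: cvgB; apply: cvgM; try exact: cvg_cst.
  exact: (@cvg_snd _ _ (nbhs x.1) (nbhs x.2)).
exact: (@cvg_fst _ _ (nbhs x.1) (nbhs x.2)).
Qed.

Lemma norm_lens_compact p : compact [set x | N x <= 2 /\ N (x - p) <= 2].
Proof.
have [K KN] := norm_le_bounded hN 2.
apply: (@subclosed_compact _ _ (`[- K, K]%classic `*` `[- K, K]%classic)).
- apply: closedI.
    apply: (@closed_comp _ _ N [set t | t <= 2]); last exact: closed_le.
    by move=> x _; exact: plane_norm_continuous.
  apply: (@closed_comp _ _ (fun x => N (x - p)) [set t | t <= 2]); last exact: closed_le.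
  move=> x _; apply: continuous_comp; last exact: plane_norm_continuous.
  by apply: cvgB; [exact: cvg_id|exact: cvg_cst].
- by apply: compact_setX; exact: segment_compact.
- move=> [x y] [/KN + _]; have -> : `|(x, y)| = Num.max `|x| `|y| :> R by [].
  by rewrite ge_max !ler_norml => /andP[xK yK]; split; rewrite /= in_itv.
Qed.

Lemma norm_convex_lt (s t : R) x y : 0 < s -> 0 <= t -> s + t = 1 -> N x < 2 -> N y <= 2 ->
  N (s *: x + t *: y) < 2.
Proof.
move=> s0 t0 st x2 y2; rewrite (le_lt_trans (plane_normD hN _ _))//.
by rewrite !(plane_normZ hN) gtr0_norm// ger0_norm//; nra.
Qed.

(* q maximises cross p on the lens: a point of the same height interior to both
   discs could be moved up, and if N q < 2 or N (q - p) < 2 then sliding q along p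
   yields such a point. *)
Lemma exists_lens_apex p : N p = 2 -> exists q, [/\ 0 < cross p q, N q = 2, N (q - p) = 2 &
  forall w, cross p q <= cross p w -> N w < 2 -> N (w - p) < 2 -> False].
Proof.
(* [e] is [p] turned by a right angle, the direction in which [cross p] grows; [h] is the squared
   Euclidean length of [p]. *)
move=> Np; pose e : R * R := (- p.2, p.1); pose h := cross p e.
have p0 : p != 0 by apply/eqP => p0; move: Np; rewrite p0 plane_norm0// => /eqP; rewrite eq_sym pnatr_eq0.
have h0 : 0 < h.
  rewrite /h /cross /e /=; rewrite mulrN opprK -!expr2.
  have [p1|p1] := eqVneq p.1 0; last by rewrite ltr_pwDl ?sqr_ge0// exprn_even_gt0.
  rewrite ltr_wpDl ?sqr_ge0// exprn_even_gt0//=.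
  by apply: contraNneq p0 => p2; apply/eqP/plane_eq.
have Ne := plane_norm_ge0 hN e.
have crossD w s : cross p (w + s *: e) = cross p w + s * h.
  by rewrite /h /cross /= /GRing.scale /=; ring.
have NwD w s : 0 <= s -> N (w + s *: e) <= N w + s * N e.
  by move=> s0; rewrite (le_trans (plane_normD hN _ _))// (plane_normZ hN) ger0_norm.
pose K := [set x | N x <= 2 /\ N (x - p) <= 2].
pose s0 := (N e + 1)^-1.
have s00 : 0 < s0 by rewrite invr_gt0 ltr_wpDl.
have s01 : s0 * N e <= 1 by rewrite mulrC ler_pdivrMr ?ltr_wpDl// mul1r lerDl.
(* The midpoint of 0 and [p] has norm distance 1 from both ends, and lifting it by [s0 *: e] costs
   at most 1. So the lens has a point of positive height. *)
have Kp : K (2^-1 *: p + s0 *: e).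
  have N2 : N (2^-1 *: p) = 1 by rewrite (plane_normZ hN) Np ger0_norm ?invr_ge0// mulVf// pnatr_eq0.
  split; first by rewrite (le_trans (NwD _ _ (ltW s00)))//; lra.
  rewrite (_ : _ - p = - (2^-1 *: p) + s0 *: e); last first.
    by apply: plane_eq; rewrite /= /GRing.scale /=; field.
  by rewrite (le_trans (NwD _ _ (ltW s00)))// plane_normN//; lra.
have [|q /set_mem [q1 q2] qmax] := @compact_EVT_max _ _ (cross p) K (ex_intro _ _ Kp) (@norm_lens_compact p).
  by apply: continuous_subspaceT; exact: cross_continuous.
have {}qmax w : K w -> cross p w <= cross p q by move=> /mem_set; exact: qmax.
have slack w : cross p q <= cross p w -> N w < 2 -> N (w - p) < 2 -> False.
  (* Lifting [w] by [(m * s0) *: e] costs at most the slack [m], so the lifted point is still in the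
     lens, strictly higher than [q]. *)
  move=> fw w1 w2; pose m := Num.min (2 - N w) (2 - N (w - p)).
  have m0 : 0 < m by rewrite lt_min !subr_gt0 w1.
  have sm : m * s0 * N e <= m by rewrite -mulrA ler_piMr// ltW.
  have ms : 0 < m * s0 by rewrite mulr_gt0.
  have m1 : m <= 2 - N w by rewrite ge_min lexx.
  have m2 : m <= 2 - N (w - p) by rewrite ge_min lexx orbT.
  have : K (w + (m * s0) *: e).
    split; first by rewrite (le_trans (NwD _ _ (ltW ms)))//; lra.
    by rewrite addrAC (le_trans (NwD _ _ (ltW ms)))//; lra.
  by move=> /qmax; rewrite crossD; nra.
have crossp w s : cross p (w + s *: p) = cross p w.
  by rewrite /cross /= /GRing.scale /=; ring.
exists q; split=> //.
- apply: lt_le_trans (qmax _ Kp); rewrite crossD.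
  rewrite (_ : cross p (2^-1 *: p) = 0) ?add0r ?mulr_gt0//.
  by rewrite /cross /= /GRing.scale /=; ring.
- apply/eqP; rewrite eq_le q1 leNgt; apply/negP => lt.
  have Nq := plane_norm_ge0 hN q.
  (* As [N p = 2], this shift uses up half of the slack [2 - N q]; its distance to [p] drops below 2
     since [q] itself enters the convex combination with positive weight. *)
  apply: (slack (q + ((2 - N q) / 4) *: p)); first by rewrite crossp.
    rewrite (le_lt_trans (plane_normD hN _ _))// (plane_normZ hN) Np ger0_norm; first by lra.
    by lra.
  rewrite (_ : _ - p = ((2 - N q) / 4) *: q + (1 - (2 - N q) / 4) *: (q - p)); last first.
    by apply: plane_eq; rewrite /= /GRing.scale /=; ring.
  by apply: norm_convex_lt => //; lra.
- apply/eqP; rewrite eq_le q2 leNgt; apply/negP => lt.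
  have Nq := plane_norm_ge0 hN (q - p).
  apply: (slack (q + (- ((2 - N (q - p)) / 4)) *: p)); first by rewrite crossp.
    rewrite (_ : q + _ = ((2 - N (q - p)) / 4) *: (q - p) + (1 - (2 - N (q - p)) / 4) *: q); last first.
      by apply: plane_eq; rewrite /= /GRing.scale /=; ring.
    by apply: norm_convex_lt => //; lra.
  rewrite addrAC (le_lt_trans (plane_normD hN _ _))// (plane_normZ hN) Np normrN ger0_norm; by lra.
Qed.

Variables p q : R * R.
Hypotheses (Np : N p = 2) (pq0 : 0 < cross p q) (Nq : N q = 2) (Nqp : N (q - p) = 2).
Hypothesis slack : forall w, cross p q <= cross p w -> N w < 2 -> N (w - p) < 2 -> False.

(** By symmetry [n >= 0]. For [n = 0] the vector is a multiple of [p]. For [n = 1] a short vector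
    would make [q] or [q - p] short by convexity. For [n >= 2] its midpoint with [p] would have at
    least the height of [q] and lie inside both discs, against [slack]. *)
Lemma critical_lattice_packing (m n : int) : m%:~R *: p + n%:~R *: q != 0 ->
  2 <= N (m%:~R *: p + n%:~R *: q).
Proof.
wlog n0 : m n / 0 <= n.
  move=> H; have [|n0] := leP 0 n; first exact: H.
  rewrite -oppr_eq0 -(plane_normN hN) opprD -!scaleNr -!intrN.
  by apply: H; rewrite oppr_ge0 ltW.
move=> z0; rewrite leNgt; apply/negP => z2.
have [n00|[n10|n1]] : n = 0 \/ n = 1 \/ 2 <= n by lia.
- move: z0 z2; rewrite n00 scale0r addr0 (plane_normZ hN) Np => z0.
  have m0 : m != 0 by apply: contraNneq z0 => ->; rewrite scale0r.
  have : (1 : R) <= `|m%:~R| by rewrite -intr_norm ler1z -gtz0_ge1 normr_gt0.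
  by move=> m1; rewrite ltNge => /negP; apply; lra.
- rewrite n10 scale1r in z2.
  have [m0|[m0|[m0|m0]]] : m = 0 \/ m = -1 \/ 1 <= m \/ m <= -2 by lia.
  + by move: z2; rewrite m0 scale0r add0r Nq ltxx.
  + by move: z2; rewrite m0 scaleN1r addrC Nqp ltxx.
  + have mR : (1 : R) <= m%:~R by rewrite ler1z.
    suff : N q < 2 by rewrite Nq ltxx.
    rewrite (_ : q = (m%:~R + 1)^-1 *: (m%:~R *: p + q) + (m%:~R / (m%:~R + 1)) *: (q - p)).
      have mR1 : (0 : R) < m%:~R + 1 by lra.
      apply: norm_convex_lt => //; last by rewrite Nqp.
      - by rewrite invr_gt0.
      - by apply: divr_ge0; lra.
      - by field; rewrite gt_eqF.
    have mR1 : m%:~R + 1 != 0 :> R by rewrite gt_eqF//; lra.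
    by apply: plane_eq; rewrite /= /GRing.scale /=; field.
  + have mR : m%:~R <= (-2 : R) by rewrite (_ : -2 = (-2)%:~R) ?ler_int.
    suff : N (q - p) < 2 by rewrite Nqp ltxx.
    rewrite (_ : q - p = (- m%:~R)^-1 *: (m%:~R *: p + q) + ((- m%:~R - 1) / - m%:~R) *: q).
      apply: norm_convex_lt => //; last by rewrite Nq.
      - by rewrite invr_gt0; lra.
      - by apply: divr_ge0; lra.
      - by field; rewrite lt_eqF//; lra.
    have mR1 : m%:~R != 0 :> R by rewrite lt_eqF//; lra.
    by apply: plane_eq; rewrite /= /GRing.scale /=; field.
- have nR : (2 : R) <= n%:~R by rewrite (_ : 2 = 2%:~R) ?ler_int.
  apply: (slack (w := 2^-1 *: (m%:~R *: p + n%:~R *: q) + 2^-1 *: p)).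
  + rewrite [leRHS](_ : _ = n%:~R / 2 * cross p q); first by rewrite ler_peMl ?(ltW pq0)//; lra.
    by rewrite /cross /= /GRing.scale /=; field.
  + by apply: norm_convex_lt; rewrite ?Np//; lra.
  + rewrite (_ : _ - p = 2^-1 *: (m%:~R *: p + n%:~R *: q) + 2^-1 *: (- p)); last first.
      by apply: plane_eq; rewrite /= /GRing.scale /=; field.
    by apply: norm_convex_lt; rewrite ?(plane_normN hN) ?Np//; lra.
Qed.

(** A multiple of [p] moves the point into the triangle [0, p, q] or the triangle [0, q - p, q],
    whose vertices have norm at most 2. *)
Lemma strip_cover (s t : R) : 0 <= t <= 1 -> exists k : int, N (s *: p + t *: q - k%:~R *: p) <= 2.
Proof.
move=> /andP[t0 t1]; exists (Num.floor (s + t)).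
have /andP[] := floor_frac (s + t); set k := (Num.floor _)%:~R => k0 k1.
have [s0|s0] := leP 0 (s - k).
  rewrite (_ : _ - _ = (s - k) *: p + t *: q); last by rewrite scalerBl addrAC.
  by rewrite (le_trans (plane_normD hN _ _))// !(plane_normZ hN) Np Nq !ger0_norm//; lra.
rewrite (_ : _ - _ = (k - s) *: (q - p) + (s - k + t) *: q); last first.
  by apply: plane_eq; rewrite /= /GRing.scale /=; ring.
by rewrite (le_trans (plane_normD hN _ _))// !(plane_normZ hN) Nqp Nq !ger0_norm//; lra.
Qed.

Definition coord1 x := cross x q / cross p q.
Definition coord2 x := cross p x / cross p q.

Lemma coordE x : x = coord1 x *: p + coord2 x *: q.
Proof. by apply: cramer; rewrite gt_eqF. Qed.

Lemma coord1B x y : coord1 (x - y) = coord1 x - coord1 y.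
Proof. by rewrite /coord1 /cross /=; ring. Qed.

Lemma coord2B x y : coord2 (x - y) = coord2 x - coord2 y.
Proof. by rewrite /coord2 /cross /=; ring. Qed.

Lemma coord1_comb (s t : R) : coord1 (s *: p + t *: q) = s.
Proof.
by have := lt0r_neq0 pq0; rewrite /coord1 /cross /= /GRing.scale /= => ?; field.
Qed.

Lemma coord2_comb (s t : R) : coord2 (s *: p + t *: q) = t.
Proof.
by have := lt0r_neq0 pq0; rewrite /coord2 /cross /= /GRing.scale /= => ?; field.
Qed.

Definition span_cell := [set x | (0 <= coord1 x < 1) /\ (0 <= coord2 x < 1)].

Lemma measurable_span_cell : measurable (span_cell : set plane).
Proof.
have c1 : continuous coord1.
  move=> x; apply: cvgM; last exact: cvg_cst.
  rewrite /cross; apply: cvgB; apply: cvgM; try exact: cvg_cst.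
    exact: (@cvg_fst _ _ (nbhs x.1) (nbhs x.2)).
  exact: (@cvg_snd _ _ (nbhs x.1) (nbhs x.2)).
have c2 : continuous coord2 by move=> x; apply: cvgM; [exact: cross_continuous|exact: cvg_cst].
have mc (f : R * R -> R) : continuous f -> measurable ([set x | 0 <= f x < 1] : set plane).
  move=> cf.
  rewrite (_ : [set _ | _] = f @^-1` [set t | 0 <= t] `&` f @^-1` [set t | t < 1]).
    apply: measurableI.
      by apply: closed_measurable_plane; apply: closed_comp; [move=> x _; exact: cf|exact: closed_ge].
    by apply: open_measurable_plane; apply: open_comp; [move=> x _; exact: cf|exact: open_lt].
  by apply/seteqP; split=> x /= => [/andP|H]; [|apply/andP].
by apply: measurableI; exact: mc.
Qed.

Lemma span_cell_bounded : exists K, forall x, span_cell x -> `|x| <= K.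
Proof.
exists (`|p| + `|q|) => x [/andP[s0 s1] /andP[t0 t1]].
rewrite [X in `|X|](coordE x) (le_trans (ler_normD _ _))//.
have a1 : `|coord1 x| <= 1 by rewrite ger0_norm// ltW.
have a2 : `|coord2 x| <= 1 by rewrite ger0_norm// ltW.
by apply: lerD; rewrite normrZ ler_piMl.
Qed.

Definition span_lattice := [set p *~ m.1 + q *~ m.2 | m in [set: int * int]].

Lemma spanE (i j : int) : p *~ i + q *~ j = i%:~R *: p + j%:~R *: q.
Proof. by rewrite !scaler_int. Qed.

Lemma span_full_rank : full_rank_lattice span_lattice.
Proof.
exists p, q; split=> // s t st.
have := coord1_comb s t; have := coord2_comb s t.
by rewrite st /coord1 /coord2 /cross /= !mul0r !mulr0 subrr mul0r => <- <-.
Qed.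

Lemma span_packing d : span_lattice d -> d != 0 -> 2 <= N d.
Proof.
by move=> [m _ <-]; rewrite spanE; exact: critical_lattice_packing.
Qed.

Lemma int_frac_inj (i j : int) (u : R) :
  0 <= u - i%:~R -> u - i%:~R < 1 -> 0 <= u - j%:~R -> u - j%:~R < 1 -> i = j.
Proof.
move=> i0 i1 j0 j1.
have ij : i < j + 1 by rewrite -(ltr_int R) intrD; lra.
have ji : j < i + 1 by rewrite -(ltr_int R) intrD; lra.
by lia.
Qed.

Lemma span_cell_packs : packs span_lattice span_cell.
Proof.
move=> c d x [m _ <-] [n _ <-] /translateE [] + + /translateE [].
rewrite !spanE !coord1B !coord2B !coord1_comb !coord2_comb.
move=> /andP[a1 a2] /andP[a3 a4] /andP[b1 b2] /andP[b3 b4].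
by rewrite (int_frac_inj a1 a2 b1 b2) (int_frac_inj a3 a4 b3 b4).
Qed.

Lemma span_cell_cover x : exists2 c, span_lattice c & translate c span_cell x.
Proof.
exists (p *~ Num.floor (coord1 x) + q *~ Num.floor (coord2 x)).
  by exists (Num.floor (coord1 x), Num.floor (coord2 x)).
apply/translateE; rewrite /span_cell /=.
by rewrite coord1B coord2B spanE coord1_comb coord2_comb; split; exact: floor_frac.
Qed.

End CriticalLattice.

(** * Comparison of cells of two packing lattices *)

Section Comparison.
Context {R : realType}.
Notation plane := (measurableTypeR R * measurableTypeR R)%type.
Implicit Types (x y w c d p q z : R * R) (L A D V X Y : set (R * R)).
Variable N : R * R -> R.
Hypothesis hN : plane_norm N.

Definition separated L := forall d, L d -> d != 0 -> 2 <= N d.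

Lemma lattice_mulrz L x (k : int) : lattice L -> L x -> L (k%:~R *: x).
Proof.
move=> hL Lx; have Ln (n : nat) : L (n%:R *: x).
  elim: n => [|n ih]; first by rewrite scale0r; exact: lattice0.
  by rewrite -natr1 scalerDl scale1r; exact: latticeD.
case: k => n; first exact: Ln.
by rewrite NegzE mulrNz scaleNr; apply: latticeN => //; exact: Ln.
Qed.

Lemma full_rank_dilate (a : R) L : a != 0 -> full_rank_lattice L -> full_rank_lattice (dilate a L).
Proof.
move=> a0 [b1 [b2 [ind ->]]]; exists (a *: b1), (a *: b2); split.
  move=> s t; rewrite !scalerA => /ind [/eqP + /eqP].
  by rewrite !mulf_eq0 (negbTE a0) !orbF => /eqP -> /eqP ->.
apply/seteqP; split=> x.
  by move=> [_ [m _ <-] <-]; exists m => //; rewrite scalerDr !scalerMzr.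
by move=> [m _ <-]; exists (b1 *~ m.1 + b2 *~ m.2); [exists m|rewrite scalerDr !scalerMzr].
Qed.

(** The basis vector [b1] is a nonzero competitor, which leaves finitely many candidates. *)
Lemma exists_shortest L : full_rank_lattice L ->
  exists p, [/\ L p, p != 0 & forall d, L d -> d != 0 -> N p <= N d].
Proof.
move=> hL; have lL := lattice_full_rank hL.
have [b1 [b2 [ind LE]]] := hL.
have b10 : b1 != 0.
  apply/eqP => b10; have [] := ind 1 0; first by rewrite b10 scale0r scaler0 addr0.
  by move=> /eqP; rewrite oner_eq0.
have Lb1 : L b1 by rewrite LE; exists (1, 0); rewrite //= mulr1z mulr0z addr0.
have [K KN] := norm_le_bounded hN (N b1).
pose F := L `&` [set d | d != 0 /\ N d <= N b1].
have fF : finite_set F.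
  by apply: sub_finite_set (lattice_finite lL K) => d [Ld [_ /KN]].
have [p [Lp [p0 pb]] pmin] := finite_set_min N fF (ex_intro _ b1 (conj Lb1 (conj b10 (lexx _)))).
exists p; split=> // d Ld d0; have [db|/ltW bd] := leP (N d) (N b1).
  by apply: pmin.
exact: le_trans bd.
Qed.

(** The origin is a nearest lattice point to every point of its cell. *)
Lemma voronoi_near L w c r : L c -> voronoi N L w -> N (w - c) <= r -> N w <= r.
Proof.
move=> Lc Vw cr; have [c0|c0] := eqVneq c 0; first by rewrite c0 subr0 in cr.
by rewrite (le_trans _ cr)//; have [/ltW|[->]] := Vw c Lc c0.
Qed.

(** The area of the tile [D] stands for the covolume of [L']. The radius 2 is the smallest value of
    [1 + lambda]. *)
Lemma critical_alternative L : full_rank_lattice L -> separated L ->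
  (exists2 p, L p & N p = 2) ->
  exists L' (D : set plane), [/\ full_rank_lattice L', separated L', measurable D, packs L' D &
    [/\ forall x, exists2 c, L' c & translate c D x, exists K, forall x, D x -> `|x| <= K &
     (area D <= area (voronoi N L `&` [set x | (N x <= 2)%R]))%E]].
Proof.
move=> hL sL [p Lp Np]; have lL := lattice_full_rank hL.
have [q [pq0 Nq Nqp slack]] := exists_lens_apex hN Np.
have mV := measurable_voronoi hN lL.
have m2 := measurable_norm_le hN 2.
have [[g Lg gt]|far] := pselect (exists2 g, L g & 0 < `|coord2 p q g| < 1).
  have [g' Lg' gt'] : exists2 g', L g' & 0 < coord2 p q g' < 1.
    have [g0|g0] := leP 0 (coord2 p q g); first by exists g => //; rewrite ger0_norm in gt.
    exists (0 - g); first by apply: latticeB => //; exact: lattice0.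
    rewrite coord2B (_ : coord2 p q 0 = 0); last by rewrite /coord2 /cross /= !mulr0 subrr mul0r.
    by rewrite sub0r; rewrite ltr0_norm in gt.
  move: gt' => /andP[t0 t1].
  (* Subtracting a multiple of [g'] brings the second coordinate of [x] into [[0, 1)], that is, into
     the strip covered by the discs around multiples of [p]. *)
  have cov x : exists2 c, L c & N (x - c) <= 2.
    pose k := Num.floor (coord2 p q x / coord2 p q g').
    pose y := x - k%:~R *: g'.
    have y01 : 0 <= coord2 p q y <= 1.
      have -> : coord2 p q y = (coord2 p q x / coord2 p q g' - k%:~R) * coord2 p q g'.
        rewrite /y coord2B mulrBl divfK ?gt_eqF//; congr (_ - _).
        by rewrite /coord2 /cross /= /GRing.scale /=; ring.
      have /andP[f0 f1] := floor_frac (coord2 p q x / coord2 p q g').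
      rewrite -/k in f0 f1; apply/andP; split; first by rewrite mulr_ge0// ltW.
      by nra.
    have [j] := strip_cover hN Np Nq Nqp (coord1 p q y) y01.
    rewrite -(coordE pq0 y) => Nj; exists (k%:~R *: g' + j%:~R *: p).
      by apply: latticeD => //; exact: lattice_mulrz.
    by rewrite opprD addrA.
  exists L, (voronoi N L); split=> //.
    exact: voronoi_packs.
  split; [by move=> x; exact: voronoi_cover|exact: voronoi_bounded|].
  apply: area_measure_subset => //; first exact: measurableI.
  by move=> w Vw; split=> //=; have [c Lc cw] := cov w; exact: (voronoi_near Lc Vw cw).
(* No vector of [L] has second coordinate strictly between 0 and 1 in absolute value. *)
exists (span_lattice p q), (span_cell p q); split.
- exact: span_full_rank.
- by move=> d; exact: span_packing.
- exact: measurable_span_cell.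
- exact: span_cell_packs.
split.
- exact: span_cell_cover.
- exact: span_cell_bounded.
pose A := \bigcup_(c in L) translate c [set x | N x <= 2].
have mA : measurable (A : set plane).
  by apply: lattice_bigcup_measurable => // c _; exact: measurable_translate.
apply: (@le_trans _ _ (area (voronoi N L `&` A))).
  apply: (area_packs_le_cover lL) => //.
  - exact: measurable_span_cell.
  - move=> c x Lc [d Ld /translateE dx]; exists (d + c); first exact: latticeD.
    by apply/translateE; rewrite opprD addrACA subrr addr0.
  - move=> x [/andP[s0 s1] /andP[t0 t1]].
    have [|j] := @strip_cover _ _ hN _ _ Np Nq Nqp (coord1 p q x) (coord2 p q x).
      by rewrite t0 ltW.
    rewrite -(coordE pq0 x) => Nj; exists (j%:~R *: p); first exact: lattice_mulrz.
    by apply/translateE.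
  (* If two translates met, both coordinates of [c - d] would be below 1 in absolute value. By [far]
     the second one vanishes, so [c - d] is a multiple of [p] of norm below 2. *)
  - move=> c d x Lc Ld /translateE [/andP[s0 s1] /andP[t0 t1]] /translateE [/andP[s2 s3] /andP[t2 t3]].
    apply/eqP; rewrite -subr_eq0; apply: contrapT => /negP cd0.
    have Lcd := latticeB lL Lc Ld.
    have t4 : `|coord2 p q (c - d)| < 1.
      have -> : coord2 p q (c - d) = coord2 p q (x - d) - coord2 p q (x - c) by rewrite !coord2B; ring.
      by rewrite ltr_norml; apply/andP; split; lra.
    have s4 : `|coord1 p q (c - d)| < 1.
      have -> : coord1 p q (c - d) = coord1 p q (x - d) - coord1 p q (x - c) by rewrite !coord1B; ring.
      by rewrite ltr_norml; apply/andP; split; lra.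
    have [t5|t5] := eqVneq (coord2 p q (c - d)) 0.
      have := sL _ Lcd cd0; rewrite leNgt => /negP; apply.
      by rewrite (coordE pq0 (c - d)) t5 scale0r addr0 (plane_normZ hN) Np; lra.
    by apply: far; exists (c - d) => //; rewrite normr_gt0 t5.
  - by move=> x; exact: voronoi_cover.
  - exact: span_cell_bounded.
  - exact: voronoi_bounded.
apply: area_measure_subset; [exact: measurableI|exact: measurableI|].
move=> w [Vw [c Lc /translateE cw]]; split=> //.
exact: (voronoi_near Lc Vw cw).
Qed.

Lemma exists_denser_lattice L : full_rank_lattice L -> separated L ->
  exists L' (D : set plane), [/\ full_rank_lattice L', separated L', measurable D, packs L' D &
    [/\ forall x, exists2 c, L' c & translate c D x, exists K, forall x, D x -> `|x| <= K &
     (area D <= area (voronoi N L `&` [set x | (N x <= 2)%R]))%E]].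
Proof.
move=> hL sL; have [p [Lp p0 pmin]] := exists_shortest hL.
have Np2 := sL p Lp p0.
pose a := N p / 2; have a1 : 1 <= a by rewrite ler_pdivlMr// mul1r.
have a0 : 0 < a by lra.
pose L0 := dilate a^-1 L.
have hL0 : full_rank_lattice L0 by apply: full_rank_dilate; rewrite ?invr_eq0 ?gt_eqF.
have LE : L = dilate a L0.
  apply/seteqP; split=> x; last by move=> [_ [y Ly <-] <-]; rewrite scalerA divff ?gt_eqF// scale1r.
  by move=> Lx; exists (a^-1 *: x); [exists x|rewrite scalerA divff ?gt_eqF// scale1r].
have sL0 : separated L0.
  move=> _ [d Ld <-] d0; have {}d0 : d != 0 by apply: contraNneq d0 => ->; rewrite scaler0.
  rewrite (plane_normZ hN) gtr0_norm ?invr_gt0// mulrC ler_pdivlMr// /a.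
  by have := pmin d Ld d0; lra.
have p02 : exists2 p0, L0 p0 & N p0 = 2.
  exists (a^-1 *: p); first by exists p.
  by rewrite (plane_normZ hN) gtr0_norm ?invr_gt0// /a; field; rewrite gt_eqF//; lra.
have [L' [D [h1 h2 h3 h4 [h5 h6 h7]]]] := critical_alternative hL0 sL0 p02.
exists L', D; split=> //; split=> //; apply: (le_trans h7).
have lL0 := lattice_full_rank hL0; have lL := lattice_full_rank hL.
apply: area_measure_subset.
- by apply: measurableI; [exact: measurable_voronoi|exact: measurable_norm_le].
- by apply: measurableI; [exact: measurable_voronoi|exact: measurable_norm_le].
- move=> x [Vx x2]; split=> //; rewrite LE; exact: voronoi_scale.
Qed.

End Comparison.

(** * Estimates of the two densities *)

Section Densities.
Context {R : realType}.
Notation plane := (measurableTypeR R * measurableTypeR R)%type.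
Implicit Types (x y w c d p q z : R * R) (L A D V X Y : set (R * R)).
Variables (M : set (R * R)) (lambda : R).
Hypotheses (hM : symmetric_convex_body M) (lambda1 : 1 <= lambda).
Notation N := (body_norm M).
Let hN : plane_norm N := plane_norm_body hM.
Notation E := (@euclid R).
Let hE : plane_norm E := @plane_norm_euclid R.

Lemma area_euclid_fin (A : set plane) r : measurable A -> A `<=` disk E r ->
  exists2 v : R, 0 <= v & area A = v%:E.
Proof.
move=> mA Ar; have [K KE] := norm_le_bounded hE r.
have fin : (area A < +oo)%E by apply: (@area_bounded_lty _ A K mA) => x /Ar /KE.
exists (fine (area A)); first by apply: fine_ge0; exact: measure_ge0.
by rewrite fineK// ge0_fin_numE// measure_ge0.
Qed.

Lemma bounded_euclid (A : set (R * R)) : (exists K, forall x, A x -> `|x| <= K) ->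
  exists2 rho, 0 < rho & A `<=` disk E rho.
Proof.
move=> [K AK]; have [b b0 Eb] := plane_norm_upper hE.
exists (b * `|K| + 1); first by rewrite ltr_wpDl// mulr_ge0// ltW.
move=> x /AK xK; rewrite /disk /= (le_trans (Eb x))// (@le_trans _ _ (b * `|K|)) ?lerDl//.
by rewrite ler_pM2l// (le_trans xK)// ler_norm.
Qed.

Lemma lattice_packingP L : lattice_packing M L <-> full_rank_lattice L /\ separated N L.
Proof.
split=> -[hL H]; split=> //.
  move=> d Ld d0; rewrite -(subr0 d); apply: H => //.
  by apply: lattice0; exact: lattice_full_rank.
move=> c c' Lc Lc' cc; apply: H; first exact: (latticeB (lattice_full_rank hL)).
by rewrite subr_eq0.
Qed.

Lemma packing_unionE L : packing_union M L = \bigcup_(c in L) translate c (disk N 1).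
Proof. by rewrite /packing_union /disk -(body_norm_ball hM). Qed.

Lemma soft_packing_unionE L : soft_packing_union lambda M L =
  \bigcup_(c in L) translate c (disk N (1 + lambda)).
Proof.
have l0 : 0 < 1 + lambda by rewrite ltr_pwDl// (le_trans ler01).
by rewrite /soft_packing_union (dilate_body hM l0).
Qed.

Lemma measurable_packing_union L r : lattice L ->
  measurable (\bigcup_(c in L) translate c (disk N r) : set plane).
Proof.
move=> hL; apply: lattice_bigcup_measurable => // c _.
by apply: measurable_translate; exact: measurable_disk.
Qed.

Lemma periodic_packing_union L X : lattice L -> periodic L (\bigcup_(c in L) translate c X).
Proof.
move=> hL c x Lc [d Ld /translateE dx]; exists (d + c); first exact: latticeD.
by apply/translateE; rewrite opprD addrACA subrr addr0.
Qed.

Lemma disk_sub_packing_union L r : lattice L -> disk N r `<=` \bigcup_(c in L) translate c (disk N r).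
Proof. by move=> hL x Nx; exists 0; [exact: lattice0|apply/translateE; rewrite subr0]. Qed.

(** The boundary of [M] has no area: for [t < 1] the open ball contains the closed ball of radius
    [t], of area [t ^+ 2 * m]. *)
Lemma open_disk_area m : area (disk N 1) = m%:E -> 0 < m -> (m%:E <= area [set x | (N x < 1)%R])%E.
Proof.
move=> mE m0.
have mU := measurable_norm_lt hN 1.
have U1 : (area [set x | (N x < 1)%R] <= m%:E)%E.
  by rewrite -mE; apply: area_measure_subset => //; [exact: measurable_disk|move=> x /ltW].
have /fineK uE : (area [set x | (N x < 1)%R]) \is a fin_num.
  rewrite ge0_fin_numE ?(le_lt_trans U1) ?ltry//; exact: measure_ge0.
rewrite -uE lee_fin; set u := fine _ in uE *.
have H t : 0 < t -> t < 1 -> t ^+ 2 * m <= u.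
  move=> t0 t1; rewrite -lee_fin uE EFinM -mE -(area_disk hN t0).
  apply: area_measure_subset => //; first exact: measurable_disk.
  by move=> x; rewrite /disk /= => /le_lt_trans; apply.
rewrite leNgt; apply/negP => um.
have u0 : 0 <= u by apply: fine_ge0; exact: measure_ge0.
(* With [t = 1 - s], the area [t ^+ 2 * m] exceeds [m - (m - u) / 2], hence [u]. *)
pose s := (m - u) / (4 * m).
have sm : s * m = (m - u) / 4 by rewrite /s; field; rewrite gt_eqF.
have m4 : 0 < 4 * m by rewrite mulr_gt0.
have s0 : 0 < s by rewrite divr_gt0 ?subr_gt0.
have s1 : s < 1.
  rewrite /s ltr_pdivrMr// mul1r; clearbody u; lra.
have := H (1 - s) (ltac:(by rewrite subr_gt0)) (ltac:(by rewrite ltrBlDr ltrDl)).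
rewrite leNgt => /negP; apply.
have -> : (1 - s) ^+ 2 * m = m - 2 * (s * m) + s * (s * m) by ring.
have := mulr_gt0 s0 (mulr_gt0 s0 m0).
by rewrite sm => ?; lra.
Qed.

(** Disjoint open balls bound the covered area from below by a count of centers, and the tile [D]
    bounds that count by the area of a slightly smaller disk over [delta]. *)
Lemma packing_density_ge L (D : set plane) m delta : full_rank_lattice L -> separated N L ->
  measurable D -> packs L D -> (forall x, exists2 c, L c & translate c D x) ->
  (exists K, forall x, D x -> `|x| <= K) ->
  area (disk N 1) = m%:E -> 0 < m -> area D = delta%:E -> 0 < delta ->
  ((m / delta)%:E <= packing_density M L)%E.
Proof.
move=> fL sL mD pD cD bD mE m0 dE d0; have hL := lattice_full_rank fL.
have [rho1 r10 D1] := bounded_euclid bD.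
have [rho2 r20 M2] := bounded_euclid (norm_le_bounded hN 1).
pose rho := rho1 + rho2.
have rho0 : 0 < rho by rewrite addr_gt0.
have Dr : D `<=` disk E rho by move=> x /D1; rewrite /disk /rho /=; lra.
have Mr : disk N 1 `<=` disk E rho by move=> x /M2; rewrite /disk /rho /=; lra.
have [e e0 eE] := area_disk1 hE.
apply: limf_esup_ge => k' k'm; set k := m / delta in k'm *.
have k0 : 0 < k by rewrite divr_gt0.
(* Beyond [r0] one has [k' * r ^+ 2 <= k * (r - 2 * rho) ^+ 2], which absorbs the boundary
   effects. *)
pose r0 := Num.max (2 * rho) (4 * rho * k / (k - k')).
exists r0 => r; rewrite gt_max => /andP[r2 rk].
have rp : 0 < r by lra.
have kk : 4 * rho * k < r * (k - k') by rewrite -ltr_pdivrMr ?subr_gt0.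
rewrite (dilate_unit_disk rp) packing_unionE -/(disk E r) (area_disk hE rp) eE -EFinM.
have r2e : 0 < r ^+ 2 * e by rewrite mulr_gt0// exprn_gt0.
rewrite inver gt_eqF// lee_pdivlMr// -EFinM.
pose U := [set x | N x < 1].
have mU : measurable (U : set plane) := measurable_norm_lt hN 1.
have [_ cnt] := lattice_count_bounds hE hL mD Dr pD cD dE eE (ltW rho0) r2.
have UM : U `<=` disk N 1 by move=> x /ltW.
have pU : packs L U.
  move=> c d x Lc Ld /translateE cx /translateE dx.
  by apply: (voronoi_packs hL Lc Ld (x := x)); apply/translateE;
    exact: (ball_sub_voronoi hN sL).
have := @disk_packs_ge _ _ hE _ hL U (\bigcup_(c in L) translate c (disk N 1)) rho r mU
  (measurable_packing_union 1 hL) (subset_trans UM Mr) pU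
  (subset_trans UM (disk_sub_packing_union hL)) (periodic_packing_union hL).
apply: le_trans; apply: (@le_trans _ _ ((lattice_count E L (r - rho))%:R%:E * m%:E)%E); last first.
  by apply: lee_wpmul2l; [rewrite lee_fin|exact: open_disk_area].
rewrite -EFinM lee_fin.
rewrite -(ler_pM2r d0) [leRHS]mulrAC; apply: (@le_trans _ _ ((r - 2 * rho) ^+ 2 * e * m)).
  have -> : k' * (r ^+ 2 * e) * delta = k' * r ^+ 2 * (e * delta) by ring.
  have -> : (r - 2 * rho) ^+ 2 * e * m = k * (r - 2 * rho) ^+ 2 * (e * delta).
    by rewrite /k; field; rewrite gt_eqF.
  rewrite ler_pM2r ?mulr_gt0//.
  have -> : k * (r - 2 * rho) ^+ 2 = k' * r ^+ 2 + (r * (r * (k - k') - 4 * rho * k) + k * (2 * rho) ^+ 2) by ring.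
  by rewrite lerDl addr_ge0// mulr_ge0 ?sqr_ge0 ?subr_ge0 ?(ltW kk) ?(ltW k0) ?(ltW rp).
by rewrite ler_pM2r.
Qed.

(** The numerator is at most [m] per center, the denominator at least [y] per center, and the two
    counts of centers have ratio tending to 1. *)
Lemma soft_packing_density_le L m (y : R) : full_rank_lattice L -> separated N L ->
  area (disk N 1) = m%:E -> 0 < m ->
  area (voronoi N L `&` disk N 2) = y%:E -> 0 < y ->
  (soft_packing_density lambda M L <= (m / y)%:E)%E.
Proof.
move=> fL sL mE m0 yE y0; have hL := lattice_full_rank fL.
have [rho1 r10 D1] := bounded_euclid (voronoi_bounded hN hL).
have [rho2 r20 M2] := bounded_euclid (norm_le_bounded hN 1).
pose rho := rho1 + rho2.
have rho0 : 0 < rho by rewrite addr_gt0.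
have Dr : voronoi N L `<=` disk E rho by move=> x /D1; rewrite /disk /rho /=; lra.
have Mr : disk N 1 `<=` disk E rho by move=> x /M2; rewrite /disk /rho /=; lra.
have [e e0 eE] := area_disk1 hE.
have mV := measurable_voronoi hN hL.
have cV x := voronoi_cover hN x hL.
have pV := @voronoi_packs _ N L hL.
have [delta d0 dE] := cell_area hE hL mV Dr cV.
apply: limf_esup_le => k' k'm; set k := m / y in k'm *.
have k0 : 0 < k by rewrite divr_gt0.
(* Beyond [r0] one has [k * (r + 2 * rho) ^+ 2 <= k' * (r - 2 * rho) ^+ 2]. *)
pose r0 := Num.max (2 * rho) (4 * rho * (k' + k) / (k' - k)).
exists r0 => r; rewrite gt_max => /andP[r2 rk].
have rp : 0 < r by lra.
have kk : 4 * rho * (k' + k) < r * (k' - k) by rewrite -ltr_pdivrMr ?subr_gt0.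
rewrite (dilate_unit_disk rp) packing_unionE soft_packing_unionE -/(disk E r).
set P := \bigcup_(c in L) _; set Q := \bigcup_(c in L) _.
have mP : measurable (P : set plane) := measurable_packing_union 1 hL.
have mQ : measurable (Q : set plane) := measurable_packing_union (1 + lambda) hL.
have mr : measurable (disk E r : set plane) by exact: measurable_disk.
have [cnt1 cnt2] := lattice_count_bounds hE hL mV Dr pV cV dE eE (ltW rho0) r2.
have mM : measurable (disk N 1 : set plane) by exact: measurable_disk.
have num := @disk_cover_le _ _ hE _ hL (disk N 1) P rho r mM mP Mr (@subset_refl _ _).
have mY : measurable (voronoi N L `&` disk N 2 : set plane).
  by apply: measurableI => //; exact: measurable_disk.
have pY : packs L (voronoi N L `&` disk N 2).
  move=> c d x Lc Ld /translateE [cx _] /translateE [dx _].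
  by apply: (pV _ _ x Lc Ld); apply/translateE.
(* This is where [1 <= lambda] enters: the ball of radius 2 lies in that of radius [1 + lambda]. *)
have YQ : voronoi N L `&` disk N 2 `<=` Q.
  apply: subset_trans (disk_sub_packing_union hL) => x [_].
  by move/le_trans; apply; rewrite (_ : 2 = 1 + 1)// lerD2l.
have den := @disk_packs_ge _ _ hE _ hL _ Q rho r mY mQ (subset_trans (@subIsetl _ _ _) Dr) pY YQ
  (periodic_packing_union hL).
have [v v0 vE] := @area_euclid_fin (Q `&` disk E r) r (measurableI _ _ mQ mr) (@subIsetr _ _ _).
rewrite vE yE -EFinM lee_fin in den; rewrite mE -EFinM in num.
set n1 := (lattice_count E L (r + rho))%:R in num cnt1.
set n2 := (lattice_count E L (r - rho))%:R in den cnt2.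
have rr : 0 < (r - 2 * rho) ^+ 2 by rewrite exprn_gt0// subr_gt0.
(* Positivity of the count makes the denominator nonzero, so that the extended quotient is the real
   one. *)
have n20 : 0 < n2 by rewrite -(pmulr_lgt0 _ d0) (lt_le_trans _ cnt2)// mulr_gt0.
have vp : 0 < v by rewrite (lt_le_trans _ den)// mulr_gt0.
have k'0 : 0 < k' by rewrite (lt_trans k0).
rewrite vE inver gt_eqF// lee_pdivrMr// (le_trans num)// -EFinM lee_fin.
apply: (@le_trans _ _ (k' * (n2 * y))); last by rewrite ler_pM2l.
have my : m = k * y by rewrite /k divfK// gt_eqF.
clearbody k; rewrite my !mulrA ler_pM2r// -(ler_pM2r d0).
apply: (@le_trans _ _ ((r + 2 * rho) ^+ 2 * e * k)).
  by rewrite mulrAC ler_pM2r.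
apply: (@le_trans _ _ (k' * ((r - 2 * rho) ^+ 2 * e))); last by rewrite -(mulrA k') ler_pM2l.
rewrite mulrAC mulrA ler_pM2r//.
have -> : k' * (r - 2 * rho) ^+ 2 = (r + 2 * rho) ^+ 2 * k +
  (r * (r * (k' - k) - 4 * rho * (k' + k)) + (k' - k) * (2 * rho) ^+ 2) by ring.
by rewrite lerDl addr_ge0// mulr_ge0 ?sqr_ge0 ?subr_ge0 ?(ltW kk) ?(ltW k'm) ?(ltW rp).
Qed.

Lemma packing_density_le_soft L : full_rank_lattice L ->
  (packing_density M L <= soft_packing_density lambda M L)%E.
Proof.
move=> fL; have hL := lattice_full_rank fL; apply: le_limf_esup => r r0.
rewrite (dilate_unit_disk r0) -/(disk E r) soft_packing_unionE.
have mQ := measurable_packing_union (1 + lambda) hL.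
have mr : measurable (disk E r : set plane) by exact: measurable_disk.
apply: lee_wpmul2l; first exact: measure_ge0.
rewrite lee_pV2 ?inE ?measure_ge0//.
by apply: area_measure_subset; [exact: measurableI|exact: mr|exact: subIsetr].
Qed.

End Densities.

Theorem corollary1p6 (R : realType) (M : set (R * R)) (lambda : R)
    (hM : symmetric_convex_body M) (hlambda : 1 <= lambda) :
  soft_lattice_density lambda M = lattice_density M.
Proof.
have hN := plane_norm_body hM.
apply/eqP; rewrite eq_le; apply/andP; split; last first.
  apply: ge_ereal_sup => _ [L hL <-]; apply: le_ereal_sup_tmp.
  exists (soft_packing_density lambda M L); first by exists L.
  by apply: packing_density_le_soft => //; case: hL.
apply: ge_ereal_sup => _ [L /lattice_packingP[fL sL] <-].
have [L' [D [fL' sL' mD pD [cD bD DY]]]] := exists_denser_lattice hN fL sL.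
have [m m0 mE] := area_disk1 hN.
have [rho rho0 Dr] := bounded_euclid bD.
have [delta d0 dE] := cell_area (@plane_norm_euclid R) (lattice_full_rank fL') mD Dr cD.
have lL := lattice_full_rank fL.
have [rho' rho'0 Vr] := bounded_euclid (voronoi_bounded hN lL).
have mY : measurable (voronoi (body_norm M) L `&` disk (body_norm M) 2 :
    set (measurableTypeR R * measurableTypeR R)).
  by apply: measurableI; [exact: measurable_voronoi|exact: measurable_disk].
have [y _ yE] := area_euclid_fin mY (subset_trans (@subIsetl _ _ _) Vr).
have dy : delta <= y by rewrite -lee_fin -dE -yE.
have y0 : 0 < y by exact: lt_le_trans dy.
(* The soft density of [L] is at most [m / y], then [m / y <= m / delta] since [delta <= y], and
   [m / delta] is at most the density of [L']. *)
apply: (le_trans (soft_packing_density_le hM hlambda fL sL mE m0 yE y0)).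
apply: le_ereal_sup_tmp; exists (packing_density M L').
  by exists L' => //; exact/lattice_packingP.
apply: le_trans (packing_density_ge hM fL' sL' mD pD cD bD mE m0 dE d0).
by rewrite lee_fin ler_pM2l// lef_pV2.
Qed.
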